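(* Let $A,B,D,\widetilde{A},\widetilde{B},\widetilde{D}$ be C$^*$-algebras with inclusions $A\subseteq\widetilde{A}$, $B\subseteq\widetilde{B}$, $D\subseteq\widetilde{D}$, $D\subseteq A$, $D\subseteq B$, $\widetilde{D}\subseteq\widetilde{A}$, $\widetilde{D}\subseteq\widetilde{B}$ which are compatible, i.e. the two composite inclusions $D\hookrightarrow A\hookrightarrow\widetilde{A}$ and $D\hookrightarrow\widetilde{D}\hookrightarrow\widetilde{A}$ coincide, and the two composite inclusions $D\hookrightarrow B\hookrightarrow\widetilde{B}$ and $D\hookrightarrow\widetilde{D}\hookrightarrow\widetilde{B}$ coincide. Let $\lambda:A*_DB\to\widetilde{A}*_{\widetilde{D}}\widetilde{B}$ be the resulting $*$-homomorphism of full amalgamated free product C$^*$-algebras. Suppose one of the following holds: (i) $D=0$; (ii) $D=\mathbf{C}$, $A$ and $B$ are unital and the inclusions $D\hookrightarrow A$ and $D\hookrightarrow B$ are unital. Suppose there are $\tilde{d}\in\widetilde{D}$, $a\in A$ and $b\in B$ such that $a\tilde{d}\in A\setminus\{0\}$, $\tilde{d}b\in B$ and $\tilde{d}b\notin\mathbf{C}b$. Then $\lambda$ is not injective.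
   Context: Products $a\tilde{d}$ are taken in $\widetilde{A}$ and products $\tilde{d}b$ in $\widetilde{B}$. Given C$^*$-algebras $A,B,D$ with injective $*$-homomorphisms $\phi_A:D\to A$ and $\phi_B:D\to B$, the full amalgamated free product $A*_DB$ is the C$^*$-algebra equipped with injective $*$-homomorphisms $\sigma_A:A\to A*_DB$ and $\sigma_B:B\to A*_DB$ such that $\sigma_A\circ\phi_A=\sigma_B\circ\phi_B$, $A*_DB$ is generated by $\sigma_A(A)\cup\sigma_B(B)$, and whenever $\mathfrak{C}$ is a C$^*$-algebra and $\pi_A:A\to\mathfrak{C}$, $\pi_B:B\to\mathfrak{C}$ are $*$-homomorphisms with $\pi_A\circ\phi_A=\pi_B\circ\phi_B$, there is a $*$-homomorphism $\pi:A*_DB\to\mathfrak{C}$ with $\pi\circ\sigma_A=\pi_A$ and $\pi\circ\sigma_B=\pi_B$. The map $\lambda$ is the one obtained from this universal property applied to the compositions $A\hookrightarrow\widetilde{A}\to\widetilde{A}*_{\widetilde{D}}\widetilde{B}$ and $B\hookrightarrow\widetilde{B}\to\widetilde{A}*_{\widetilde{D}}\widetilde{B}$. *)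

(* Defs.v *)
From HB Require Import structures.
From mathcomp Require Import all_boot all_order all_algebra.
From mathcomp Require Import complex.
From mathcomp Require Import all_classical all_reals all_analysis.

Set Implicit Arguments.
Unset Strict Implicit.
Unset Printing Implicit Defensive.

Import Order.TTheory GRing.Theory Num.Theory.
Import numFieldNormedType.Exports.

Local Open Scope classical_set_scope.
Local Open Scope ring_scope.
Local Open Scope complex_scope.

Reserved Notation "x ** y" (at level 40, left associativity).
Reserved Notation "{ 'starhom' A -> B }" (at level 0, A at level 98,
  B at level 99, format "{ 'starhom'  A  ->  B }").

(* C*-algebras are not assumed unital, nor nonzero, so the product cannot be
   that of a (unital) ring structure. The norm takes values in R[i]. *)
HB.mixin Record isCStarAlgebra (R : realType) A
    of CompleteNormedModule R[i] A := {
  cmul : A -> A -> A;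
  cstar : A -> A;
  cmulA : associative cmul;
  cmulDl : left_distributive cmul +%R;
  cmulDr : right_distributive cmul +%R;
  cmulZl : forall (k : R[i]) (x y : A), cmul (k *: x) y = k *: cmul x y;
  cmulZr : forall (k : R[i]) (x y : A), cmul x (k *: y) = k *: cmul x y;
  cstarD : {morph cstar : x y / x + y};
  cstarZ : forall (k : R[i]) (x : A), cstar (k *: x) = k^* *: cstar x;
  cstarM : forall x y : A, cstar (cmul x y) = cmul (cstar y) (cstar x);
  cstarK : involutive cstar;
  cnormM : forall x y : A, `|cmul x y| <= `|x| * `|y|;
  cnorm_starM : forall x : A, `|cmul (cstar x) x| = `|x| ^+ 2
}.

#[short(type="cstarAlgType")]
HB.structure Definition CStarAlgebra (R : realType) :=
  {A of CompleteNormedModule R[i] A & isCStarAlgebra R A}.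

Notation "x ** y" := (cmul x y) : ring_scope.

HB.mixin Record isStarHom (R : realType) (A B : cstarAlgType R)
    (f : A -> B) := {
  starhomM : {morph f : x y / x ** y};
  starhom_star : {morph f : x / cstar x}
}.

HB.structure Definition StarHom (R : realType) (A B : cstarAlgType R) :=
  {f of @GRing.Linear R[i] A B *:%R f & isStarHom R A B f}.

Notation "{ 'starhom' A -> B }" := (StarHom.type A B) : type_scope.

Section CStarAlgebraTheory.
Variable R : realType.
Implicit Types A B : cstarAlgType R.

Definition is_cunit A (e : A) : Prop := forall x : A, e ** x = x /\ x ** e = x.

Definition cunital A : Prop := exists e : A, is_cunit e.

Definition unital_hom A B (f : {starhom A -> B}) : Prop :=
  forall e : A, is_cunit e -> is_cunit (f e).

Record cstar_subalgebra A (S : set A) : Prop := {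
  csub0 : S 0;
  csubD : forall x y, S x -> S y -> S (x + y);
  csubZ : forall (k : R[i]) x, S x -> S (k *: x);
  csubM : forall x y, S x -> S y -> S (x ** y);
  csub_star : forall x, S x -> S (cstar x);
  csub_closed : closed S
}.

Definition cstar_generated A (X : set A) : set A :=
  smallest (@cstar_subalgebra A) X.

End CStarAlgebraTheory.

(* (P, sA, sB) is the full amalgamated free product of A and B over D along
   phiA and phiB. *)
Record full_amalgamated_free_product (R : realType) (A B D : cstarAlgType R)
    (phiA : {starhom D -> A}) (phiB : {starhom D -> B})
    (P : cstarAlgType R) (sA : {starhom A -> P}) (sB : {starhom B -> P}) :
    Prop := {
  fafp_injl : injective sA;
  fafp_injr : injective sB;
  fafp_amalg : sA \o phiA =1 sB \o phiB;
  fafp_gen : cstar_generated (range (sA : A -> P) `|` range (sB : B -> P)) = setT;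
  fafp_univ : forall (E : cstarAlgType R)
      (piA : {starhom A -> E}) (piB : {starhom B -> E}),
    piA \o phiA =1 piB \o phiB ->
    exists p : {starhom P -> E}, p \o sA =1 piA /\ p \o sB =1 piB
}.

(* An alias of R[i]^o, on which completeness is only available when the base
   field is a realType. *)
Definition complex_cstar (R : realType) : Type := (R[i])^o.

Section ComplexCStar.
Variable R : realType.
Local Notation C := (complex_cstar R).

HB.instance Definition _ := NormedModule.copy C (R[i])^o.

Lemma norm_le_ReIm (z : R[i]) : `|z| <= (`|complex.Re z| + `|complex.Im z|)%:C.
Proof.
rewrite {1}[z]complexE; case: z => a b /=; apply: (le_trans (ler_normD _ _)).
by rewrite normrM !normc_def /= !expr0n /= !(addr0, add0r) !expr1n !sqrtr1
  mul1r !sqrtr_sqr rmorphD /=.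
Qed.

Lemma complex_cstar_complete (F : set_system C) :
  ProperFilter F -> cauchy F -> cvg F.
Proof.
move=> FF /cauchyP Fc.
have part : forall p : R[i] -> R, {morph p : x y / x - y} ->
    (forall z, `|p z|%:C <= `|z|) -> cvg ((p : C -> R) @ F).
  move=> p pB ple; apply: cauchy_cvg; apply: cauchy_exP => e e0.
  have /Fc [x Fx] : (0 : R[i]) < e%:C by rewrite ltcR.
  exists (p x); rewrite /fmap /=; apply: filterS Fx => y.
  rewrite -!ball_normE /ball_ /= => xy.
  by rewrite -ltcR -pB; apply: le_lt_trans xy; exact: ple.
have /cvg_ex[/= a Fa] : cvg ((@complex.Re R : C -> R) @ F).
  by apply: part => [[? ?] [? ?]//|z]; exact: normc_ge_Re.
have /cvg_ex[/= b Fb] : cvg ((@complex.Im R : C -> R) @ F).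
  apply: part => [[? ?] [? ?]//|z]; case: z => x y.
  have /= := normc_ge_Re (complex.Complex y (- x)).
  by rewrite !normc_def /= sqrrN addrC.
apply/cvg_ex; exists (a +i* b : C).
apply/cvgrPdist_lt => e; rewrite ltcE /= => /andP[/eqP Ime e0].
have {Ime} -> : e = (complex.Re e)%:C by case: e Ime {e0} => r i /= ->.
have e20 : 0 < complex.Re e / 2 by rewrite divr_gt0.
move/cvgrPdist_lt/(_ _ e20) in Fa; move/cvgrPdist_lt/(_ _ e20) in Fb.
near=> z.
apply: (le_lt_trans (norm_le_ReIm _)); rewrite ltcR.
rewrite [X in _ < X]splitr ltrD //.
  have -> : complex.Re (a +i* b - z) = a - complex.Re z by case: (z).
  near: z; exact: Fa.
have -> : complex.Im (a +i* b - z) = b - complex.Im z by case: (z).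
near: z; exact: Fb.
Unshelve. all: by end_near. Qed.

HB.instance Definition _ := Uniform_isComplete.Build C complex_cstar_complete.

Let cconjM (x y : C) : ((x : R[i]) * y)^* = (y : R[i])^* * (x : R[i])^*.
Proof. by rewrite rmorphM /= mulrC. Qed.

Let cnormcM (x y : C) : `|(x : R[i]) * y : C| <= `|x| * `|y|.
Proof. by rewrite -[leLHS]/(`|(x : R[i]) * y|) normrM. Qed.

Let cnorm_starMC (x : C) : `|(x : R[i])^* * x : C| = `|x| ^+ 2.
Proof.
by rewrite -[LHS]/(`|(x : R[i])^* * x|) normrM normcJ -expr2.
Qed.

HB.instance Definition _ := @isCStarAlgebra.Build R C
  (fun x y : R[i] => x * y) (fun x : R[i] => x^* )
  (@mulrA R[i]) (@mulrDl R[i]) (@mulrDr R[i])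
  (fun k x y => esym (mulrA (k : R[i]) x y))
  (fun k x y => mulrCA (x : R[i]) k y)
  (@rmorphD _ _ (@conjc R))
  (fun k x => rmorphM (@conjc R) k x)
  cconjM (@conjcK R)
  cnormcM
  cnorm_starMC.

End ComplexCStar.

(* Main.v *)
Require Import Defs.
From HB Require Import structures.
From mathcomp Require Import all_boot all_order all_algebra.
From mathcomp Require Import complex ring lra.
From mathcomp Require Import all_classical all_reals all_analysis.

Set Implicit Arguments.
Unset Strict Implicit.
Unset Printing Implicit Defensive.

Import Order.TTheory GRing.Theory Num.Theory.
Import numFieldNormedType.Exports.

Local Open Scope classical_set_scope.
Local Open Scope ring_scope.
Local Open Scope complex_scope.

(* If lambda is injective then, as a d = a1 and d b = b1 with a1 in A nonzero and
   b1 in B not proportional to b, moving d across the product in the target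
   gives a1 b = a b1 in A *_D B. Let rho be a representation of A *_D B on a
   Hilbert space and u a self-adjoint unitary. In both cases rho is scalar on D,
   so rho on A and u rho u on B agree on D and extend to the free product; hence
   rho(a1) u rho(b) = rho(a) u rho(b1). Taking for u the reflections in
   hyperplanes gives rho(a1) t rho(b) = rho(a) t rho(b1) for every rank-one t,
   which makes rho(b) a multiple of rho(b1) once rho(a1) is nonzero. A suitable
   GNS representation excludes this. *)

(** * Norms and rates of convergence *)

(** Conjugation by u is a homomorphism only when u is unitary, so a rank-one operator cannot be
    inserted between A and B directly; a reflection differs from the identity by a rank-one
    operator, and polarization yields the others. The factor k with rho(b) = k rho(b1) is not known
    beforehand, so rho has to separate b from all multiples of b1 at once. One functional per
    multiple would not do; a sum of at most three is enough. Positive functionals are obtained by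
    Hahn-Banach in an algebra with unit, whereas for D = 0 the free product may have no unit. It is
    therefore made to act on itself by left multiplication, inside the unital algebra of its
    adjointable operators. Positivity of a functional is only useful once x^* x is known to be
    positive; this is derived from square roots given by a convergent iteration, with norm estimates
    in place of spectra. *)

Section RealNorm.
Variables (R : realType).

(** The norm is a real element of [R[i]]; its real part allows ordinary real arithmetic. *)
Definition nrm (V : normedModType R[i]) (x : V) : R := complex.Re `|x|.

Section Normed.
Variable V : normedModType R[i].
Implicit Types x y : V.

Lemma nrmE x : `|x| = (nrm x)%:C.
Proof. by rewrite /nrm RRe_real // normr_real. Qed.

Lemma nrm_ge0 x : 0 <= nrm x.
Proof. by rewrite -lecR -nrmE normr_ge0. Qed.

Lemma nrm0 : nrm (0 : V) = 0.
Proof. by apply: complexI; rewrite -nrmE normr0. Qed.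

Lemma nrm0_eq0 x : nrm x = 0 -> x = 0.
Proof. by move=> x0; apply/normr0_eq0; rewrite nrmE x0. Qed.

Lemma nrmD x y : nrm (x + y) <= nrm x + nrm y.
Proof. by rewrite -lecR rmorphD /= -!nrmE ler_normD. Qed.

Lemma nrmN x : nrm (- x) = nrm x.
Proof. by rewrite /nrm normrN. Qed.

Lemma nrmB x y : nrm (x - y) = nrm (y - x).
Proof. by rewrite /nrm distrC. Qed.

Lemma nrmZ (k : R[i]) x : nrm (k *: x) = nrm (k : R[i]^o) * nrm x.
Proof.
by apply: complexI; rewrite rmorphM /= -!nrmE normrZ.
Qed.

Lemma nrmZr (t : R) x : nrm (t%:C *: x) = `|t| * nrm x.
Proof. by rewrite nrmZ /nrm normc_def /= expr0n /= addr0 sqrtr_sqr. Qed.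

Lemma nrm_sub_trans z x y : nrm (x - y) <= nrm (x - z) + nrm (z - y).
Proof. by rewrite (le_trans _ (nrmD _ _)) // addrA subrK. Qed.

End Normed.

(** Equal to 1 at n = 0, and successive values b, b' satisfy b - b^2/2 <= b', as the square root
    iteration requires. Later it is just the null sequence against which limits are measured. *)
Definition rate (n : nat) : R := 2 / (n.+2)%:R.

Lemma rate_ge0 n : 0 <= rate n.
Proof. by rewrite divr_ge0 // ler0n. Qed.

Lemma rate_gt0 n : 0 < rate n.
Proof. by rewrite divr_gt0 // ltr0n. Qed.

Lemma rate_le1 n : rate n <= 1.
Proof. by rewrite ler_pdivrMr ?ltr0n // mul1r ler_nat. Qed.

Lemma rate_anti m n : (m <= n)%N -> rate n <= rate m.
Proof. by move=> mn; rewrite /rate ler_pM2l // lef_pV2 ?posrE ?ltr0n // ler_nat !ltnS. Qed.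

Lemma rate_lt (e : R) : 0 < e -> exists N, forall n, (N <= n)%N -> rate n < e.
Proof.
move=> e0; have /archi_boundP := divr_ge0 (ler0n R 2) (ltW e0).
set N := Num.bound _; rewrite ltr_pdivrMr // => Ne; exists N => n Nn.
rewrite ltr_pdivrMr ?ltr0n // (lt_le_trans Ne) // mulrC ler_pM2l // ler_nat.
by rewrite (leq_trans Nn) // ltnW.
Qed.

Lemma rate_le0 (c x : R) : (forall n, x <= c * rate n) -> x <= 0.
Proof.
move=> xc; rewrite leNgt; apply/negP => x0.
have c0 : 0 < c.
  have := lt_le_trans x0 (xc 0%N); rewrite /rate divff ?mulr1 //.
have [n /(_ n (leqnn n))] := rate_lt (divr_gt0 x0 c0).
by rewrite ltr_pdivlMr // mulrC ltNge xc.
Qed.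

Lemma nrm_rate_eq (V : normedModType R[i]) (x y : V) (c : R) :
  (forall n, nrm (x - y) <= c * rate n) -> x = y.
Proof.
move=> /rate_le0 xy; apply/eqP; rewrite -subr_eq0; apply/eqP/nrm0_eq0/le_anti.
by rewrite xy nrm_ge0.
Qed.

Lemma cvg_nrmP (V : normedModType R[i]) (F : set_system V) (FF : Filter F) x :
  F --> x <-> forall e, 0 < e -> F [set y | nrm (x - y) < e].
Proof.
split=> [/cvgrPdist_lt Fx e e0|Fx].
  have : F [set y | `|x - y| < e%:C] by apply: Fx; rewrite ltcR.
  by apply: filterS => y /=; rewrite nrmE ltcR.
apply/cvgrPdist_lt => e; rewrite ltcE /= => /andP[/eqP ime /Fx].
apply: filterS => y /=; rewrite nrmE.
by case: e ime => r i /= ->; rewrite (ltcR _ r).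
Qed.

Lemma cauchy_nrm (V : normedModType R[i]) (F : set_system V) :
  ProperFilter F -> cauchy F ->
  forall e, 0 < e -> exists z, F [set y | nrm (z - y) < e].
Proof.
move=> FF /cauchyP Fc e e0; have [|z Fz] := Fc e%:C; first by rewrite ltcR.
exists z; apply: filterS Fz => y.
by rewrite -ball_normE /ball_ /= nrmE ltcR.
Qed.

Lemma complete_nrm (V : completeNormedModType R[i]) (F : set_system V) :
  ProperFilter F ->
  (forall e, 0 < e -> exists z, F [set y | nrm (z - y) < e]) ->
  exists l, forall e, 0 < e -> F [set y | nrm (l - y) < e].
Proof.
move=> FF Fc.
have /cvg_ex[l /cvg_nrmP Fl] : cvg F; last by exists l.
apply: cauchy_cvg; apply/cauchyP => e.
rewrite ltcE /= => /andP[/eqP ime] /Fc[z Fz]; exists z.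
apply: filterS Fz => y /=; rewrite -ball_normE /ball_ /= nrmE.
by case: e ime => r i /= ->; rewrite (ltcR _ r).
Qed.

Lemma cauchy_rate (V : completeNormedModType R[i]) (u : nat -> V) (c : R) :
  0 < c -> (forall m n, (m <= n)%N -> nrm (u n - u m) <= c * rate m) ->
  exists l, forall n, nrm (l - u n) <= c * rate n.
Proof.
move=> c0 uc.
have [|l ul] := @complete_nrm V (u @ \oo) _.
  move=> e e0; have [N HN] := rate_lt (divr_gt0 e0 c0).
  exists (u N); exists N => // n /= Nn; rewrite nrmB.
  by rewrite (le_lt_trans (uc _ _ Nn)) // mulrC -ltr_pdivlMr // HN.
exists l => n; rewrite leNgt; apply/negP.
rewrite -subr_gt0 => /ul[N _ HN].
have /HN /= : (N <= maxn N n)%N by rewrite leq_maxl.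
rewrite ltrBrDr ltNge => /negP; apply.
apply: le_trans (nrm_sub_trans (u (maxn N n)) _ _) _.
by rewrite lerD2l uc // leq_maxr.
Qed.

End RealNorm.

(** * Square roots and positivity in C*-algebras *)

Section CStarBasics.
Variables (R : realType) (U : cstarAlgType R).
Implicit Types x y z h k : U.

Lemma cmul0l x : 0 ** x = 0.
Proof. by apply: (addrI (0 ** x)); rewrite -cmulDl !addr0. Qed.

Lemma cmul0r x : x ** 0 = 0.
Proof. by apply: (addrI (x ** 0)); rewrite -cmulDr !addr0. Qed.

Lemma cmulNl x y : - x ** y = - (x ** y).
Proof. by rewrite -scaleN1r cmulZl scaleN1r. Qed.

Lemma cmulNr x y : x ** - y = - (x ** y).
Proof. by rewrite -scaleN1r cmulZr scaleN1r. Qed.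

Lemma cmulBl x y z : (x - y) ** z = x ** z - y ** z.
Proof. by rewrite cmulDl cmulNl. Qed.

Lemma cmulBr x y z : x ** (y - z) = x ** y - x ** z.
Proof. by rewrite cmulDr cmulNr. Qed.

Lemma cstarZc (k : R[i]) x : cstar (k *: x) = conjc k *: cstar x.
Proof. exact: cstarZ. Qed.

Lemma cstarN x : cstar (- x) = - cstar x.
Proof. by rewrite -scaleN1r cstarZc rmorphN rmorph1 scaleN1r. Qed.

Lemma cstarB x y : cstar (x - y) = cstar x - cstar y.
Proof. by rewrite cstarD cstarN. Qed.

Lemma cstar0 : cstar 0 = 0 :> U.
Proof. by rewrite -{1}(subrr 0) cstarB subrr. Qed.

Lemma cstarZr (t : R) x : cstar (t%:C *: x) = t%:C *: cstar x.
Proof. by rewrite cstarZc conjc_real. Qed.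

Lemma nrmM x y : nrm (x ** y) <= nrm x * nrm y.
Proof. by rewrite -lecR rmorphM /= -!nrmE cnormM. Qed.

Lemma nrm_starM x : nrm (cstar x ** x) = nrm x ^+ 2.
Proof. by apply: complexI; rewrite rmorphXn /= -!nrmE cnorm_starM. Qed.

Lemma nrm_star x : nrm (cstar x) = nrm x.
Proof.
have le y : nrm y <= nrm (cstar y).
  have [->|y0] := eqVneq (nrm y) 0; first exact: nrm_ge0.
  have y_gt0 : 0 < nrm y by rewrite lt_def y0 nrm_ge0.
  by rewrite -(ler_pM2r y_gt0) -expr2 -nrm_starM nrmM.
by apply/le_anti; rewrite le -{2}[x]cstarK le.
Qed.

Lemma nrm_starMr x : nrm (x ** cstar x) = nrm x ^+ 2.
Proof. by rewrite -{1}[x]cstarK nrm_starM nrm_star. Qed.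

Lemma cstarM_eq0 x : cstar x ** x = 0 -> x = 0.
Proof.
move=> x0; apply/nrm0_eq0/eqP; rewrite -(@sqrf_eq0 R) -nrm_starM x0.
by rewrite nrm0.
Qed.

Definition selfadj x := cstar x = x.

Lemma nrm_sqr x : selfadj x -> nrm (x ** x) = nrm x ^+ 2.
Proof. by move=> xs; rewrite -nrm_starM xs. Qed.

Lemma selfadj_sqr0 x : selfadj x -> x ** x = 0 -> x = 0.
Proof. by move=> xs x0; apply: cstarM_eq0; rewrite xs. Qed.

Lemma selfadjD x y : selfadj x -> selfadj y -> selfadj (x + y).
Proof. by move=> xs ys; rewrite /selfadj cstarD xs ys. Qed.

Lemma selfadjN x : selfadj x -> selfadj (- x).
Proof. by move=> xs; rewrite /selfadj cstarN xs. Qed.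

Lemma selfadjB x y : selfadj x -> selfadj y -> selfadj (x - y).
Proof. by move=> xs ys; apply: selfadjD => //; apply: selfadjN. Qed.

Lemma selfadjZ (t : R) x : selfadj x -> selfadj (t%:C *: x).
Proof. by move=> xs; rewrite /selfadj cstarZr xs. Qed.

Lemma selfadjM x y : selfadj x -> selfadj y -> x ** y = y ** x ->
  selfadj (x ** y).
Proof. by move=> xs ys xy; rewrite /selfadj cstarM xs ys xy. Qed.

Lemma selfadj_sqr x : selfadj x -> selfadj (x ** x).
Proof. by move=> xs; apply: selfadjM. Qed.

Lemma selfadj_starM x : selfadj (cstar x ** x).
Proof. by rewrite /selfadj cstarM cstarK. Qed.

End CStarBasics.

(* The iteration y' = (a + y^2) / 2 started at 0 converges, for |a| <= 1, to a
   solution of (1 - y)^2 = 1 - a: it is dominated by the same iteration on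
   real numbers with a = 1, whose limit is 1. *)
Section SquareRootIteration.
Variable R : realType.

Fixpoint sqrt_bound (n : nat) : R :=
  if n is n'.+1 then 2^-1 * (1 + sqrt_bound n' ^+ 2) else 0.

Lemma sqrt_bound_ge0 n : 0 <= sqrt_bound n.
Proof. by elim: n => //= n IH; rewrite mulr_ge0 // addr_ge0 // sqr_ge0. Qed.

Lemma sqrt_bound_le1 n : sqrt_bound n <= 1.
Proof. elim: n => //= n IH; have := sqrt_bound_ge0 n; nra. Qed.

(** The gap d = 1 - r evolves by d - d^2/2, which is increasing on [0, 1]; and for b = 2/(n+2) the
    next rate is 2b/(b+2) >= b - b^2/2. *)
Lemma sqrt_bound_rate n : 1 - sqrt_bound n <= rate R n.
Proof.
elim: n => [|n IH]; rewrite /rate /=.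
  by rewrite subr0 divff.
have := sqrt_bound_le1 n; have := sqrt_bound_ge0 n.
move: IH; rewrite /rate; set r := sqrt_bound n => IH r0 r1.
have n0 : 0 <= n%:R :> R by rewrite ler0n.
set d := (1 - r).
have dE : 1 - 2^-1 * (1 + r ^+ 2) = d - d ^+ 2 / 2 by rewrite /d; field.
rewrite dE; set b := 2 / (n.+2)%:R in IH.
have b1 : b <= 1 by rewrite /b ler_pdivrMr ?ltr0n // mul1r ler_nat.
have -> : 2 / (n.+3)%:R = 2 * b / (b + 2) :> R.
  by rewrite /b -!natr1; field; lra.
have b0 : 0 < b by rewrite /b divr_gt0 // ltr0n.
rewrite ler_pdivlMr; last lra.
have : d - d ^+ 2 / 2 <= b - b ^+ 2 / 2 by rewrite /d in IH *; nra.
move=> le; apply: (@le_trans _ _ ((b - b ^+ 2 / 2) * (b + 2))).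
  by rewrite ler_pM2r //; lra.
nra.
Qed.

Variable U : cstarAlgType R.
Implicit Types a b x y z : U.

Fixpoint sqrt_iter a (n : nat) : U :=
  if n is n'.+1 then 2^-1%:C *: (a + sqrt_iter a n' ** sqrt_iter a n') else 0.

(** Two elements [a] and [b] instead of a commutant: [pos_flip_sqr] needs an element intertwining
    the roots of two different elements. *)
Lemma sqrt_iter_intertwine a b z n : a ** z = z ** b ->
  sqrt_iter a n ** z = z ** sqrt_iter b n.
Proof.
move=> az; elim: n => /= [|n IH]; first by rewrite cmul0l cmul0r.
by rewrite cmulZl cmulZr cmulDl cmulDr az -cmulA IH cmulA IH cmulA.
Qed.

Lemma sqrt_iter_comm a m n :
  sqrt_iter a m ** sqrt_iter a n = sqrt_iter a n ** sqrt_iter a m.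
Proof. by apply: sqrt_iter_intertwine; symmetry; apply: sqrt_iter_intertwine. Qed.

Lemma sqrt_iter_selfadj a n : selfadj a -> selfadj (sqrt_iter a n).
Proof.
move=> sa; elim: n => /= [|n IH]; first exact: cstar0.
by apply/selfadjZ/selfadjD => //; apply: selfadj_sqr.
Qed.

Lemma nrm_half x : nrm (2^-1%:C *: x) = 2^-1 * nrm x.
Proof. by rewrite nrmZr ger0_norm. Qed.

Lemma scale_half x : 2^-1%:C *: (x + x) = x.
Proof.
rewrite scalerDr -scalerDl -rmorphD /=.
by rewrite (_ : _ + _ = 1 :> R) ?rmorph1 ?scale1r //; field.
Qed.

Section Bounded.
Variable a : U.
Hypothesis a1 : nrm a <= 1.

Lemma sqrt_iter_bound n : nrm (sqrt_iter a n) <= sqrt_bound n.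
Proof.
elim: n => /= [|n IH]; first by rewrite nrm0.
rewrite nrm_half ler_pM2l // (le_trans (nrmD _ _)) // lerD //.
rewrite (le_trans (nrmM _ _)) // expr2 ler_pM ?nrm_ge0 //.
Qed.

Lemma sqr_diff x y : x ** y = y ** x ->
  x ** x - y ** y = (x + y) ** (x - y).
Proof. by move=> xy; rewrite cmulDl !cmulBr xy addrA subrK. Qed.

(** A difference of consecutive iterates is half of (y' + y)(y' - y), the iterates commuting; the
    real iteration obeys the same identity, so the domination propagates. *)
Lemma sqrt_iter_step n :
  nrm (sqrt_iter a n.+1 - sqrt_iter a n) <= sqrt_bound n.+1 - sqrt_bound n.
Proof.
elim: n => [|n IH].
  rewrite /= cmul0l !addr0 subr0 nrm_half expr0n /= addr0 subr0.
  by rewrite ler_pM2l.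
have -> : sqrt_iter a n.+2 - sqrt_iter a n.+1 = 2^-1%:C *:
    ((sqrt_iter a n.+1 + sqrt_iter a n) ** (sqrt_iter a n.+1 - sqrt_iter a n)).
  rewrite -sqr_diff; last exact: sqrt_iter_comm.
  rewrite [sqrt_iter a n.+2]/= [X in _ - X = _]/= -scalerBr; congr (_ *: _).
  by rewrite opprD addrACA subrr add0r.
have -> : sqrt_bound n.+2 - sqrt_bound n.+1 = 2^-1 *
    ((sqrt_bound n.+1 + sqrt_bound n) * (sqrt_bound n.+1 - sqrt_bound n)).
  by rewrite /=; field.
rewrite nrm_half ler_pM2l // (le_trans (nrmM _ _)) // ler_pM ?nrm_ge0 //.
by rewrite (le_trans (nrmD _ _)) // lerD // sqrt_iter_bound.
Qed.

(** The steps telescope to r_n - r_m <= 1 - r_m in the dominating real sequence. *)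
Lemma sqrt_iter_cauchy m n : (m <= n)%N ->
  nrm (sqrt_iter a n - sqrt_iter a m) <= rate R m.
Proof.
move=> mn; rewrite (le_trans _ (sqrt_bound_rate m)) //.
apply: (@le_trans _ _ (sqrt_bound n - sqrt_bound m)); last first.
  by rewrite lerD2r sqrt_bound_le1.
move: mn; elim: n => [|n IH]; first by rewrite leqn0 => /eqP ->; rewrite !subrr nrm0.
rewrite leq_eqVlt => /predU1P[->|]; first by rewrite !subrr nrm0.
rewrite ltnS => /IH le; apply: le_trans (nrm_sub_trans (sqrt_iter a n) _ _) _.
have := sqrt_iter_step n; lra.
Qed.

End Bounded.

(* Only meaningful when [nrm a <= 1]; otherwise it may be the default [0]. *)
Definition sqrt_fix a : U :=
  xget 0 [set l | forall n, nrm (l - sqrt_iter a n) <= rate R n].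

Section Limit.
Variable a : U.
Hypothesis a1 : nrm a <= 1.

Lemma sqrt_fixP n : nrm (sqrt_fix a - sqrt_iter a n) <= rate R n.
Proof.
have [|l Hl] := @cauchy_rate _ _ (sqrt_iter a) 1 ltr01.
  by move=> m k mk; rewrite mul1r sqrt_iter_cauchy.
rewrite /sqrt_fix; case: xgetP => [y _|/(_ l)[]]; first exact.
by move=> k; rewrite -[rate R k]mul1r.
Qed.

Lemma sqrt_fix_unique x (c : R) :
  (forall n, nrm (x - sqrt_iter a n) <= c * rate R n) -> x = sqrt_fix a.
Proof.
move=> xa; apply: (@nrm_rate_eq _ _ _ _ (c + 1)) => n.
apply: le_trans (nrm_sub_trans (sqrt_iter a n) _ _) _.
by rewrite mulrDl mul1r lerD // nrmB sqrt_fixP.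
Qed.

Lemma sqrt_fix_nrm : nrm (sqrt_fix a) <= 1.
Proof.
rewrite -subr_le0; apply: (@rate_le0 _ 1) => n.
have := nrmD (sqrt_fix a - sqrt_iter a n) (sqrt_iter a n); rewrite subrK.
have := sqrt_fixP n; have := sqrt_iter_bound a1 n; have := sqrt_bound_le1 n.
lra.
Qed.

Lemma sqrt_fix_selfadj : selfadj a -> selfadj (sqrt_fix a).
Proof.
move=> sa; apply: (@sqrt_fix_unique _ 1) => n.
by rewrite -(sqrt_iter_selfadj n sa) -cstarB nrm_star mul1r sqrt_fixP.
Qed.

(** This is (1 - y)^2 = 1 - a, expanded so as to make sense without a unit. *)
Lemma sqrt_fixE : sqrt_fix a + sqrt_fix a = a + sqrt_fix a ** sqrt_fix a.
Proof.
set y := sqrt_fix a; pose f n := sqrt_iter a n.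
suff {1 2}-> : y = 2^-1%:C *: (a + y ** y) by rewrite -scalerDr scale_half.
apply: (@nrm_rate_eq _ _ _ _ 3) => n.
apply: le_trans (nrm_sub_trans (f n.+1) _ _) _.
have le1 : nrm (y - f n.+1) <= rate R n.
  exact: le_trans (sqrt_fixP _) (rate_anti _ (leqnSn n)).
have -> : f n.+1 - 2^-1%:C *: (a + y ** y) =
   2^-1%:C *: ((f n - y) ** f n + y ** (f n - y)).
  rewrite [f n.+1]/= -scalerBr; congr (_ *: _).
  rewrite cmulBl cmulBr addrA subrK opprD addrACA subrr add0r //.
have le2 := sqrt_fixP n.
have := nrmD ((f n - y) ** f n) (y ** (f n - y)).
have := nrmM (f n - y) (f n); have := nrmM y (f n - y).
rewrite nrm_half.
have := sqrt_fix_nrm; have := sqrt_iter_bound a1 n; have := sqrt_bound_le1 n.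
rewrite -/(f n) -/y (nrmB (f n) y) in le2 *.
have := nrm_ge0 (y - f n); have := nrm_ge0 y; have := nrm_ge0 (f n).
move: (nrm (y - f n)) (nrm y) (nrm (f n)) le1 le2 => d p q *; nra.
Qed.

End Limit.

Lemma sqrt_fix_intertwine a b z : nrm a <= 1 -> nrm b <= 1 ->
  a ** z = z ** b -> sqrt_fix a ** z = z ** sqrt_fix b.
Proof.
move=> a1 b1 az; apply: (@nrm_rate_eq _ _ _ _ (nrm z + nrm z)) => n.
apply: le_trans (nrm_sub_trans (sqrt_iter a n ** z) _ _) _.
rewrite {2}(sqrt_iter_intertwine n az) -cmulBl -cmulBr mulrDl lerD //.
  by rewrite (le_trans (nrmM _ _)) // mulrC ler_wpM2l ?nrm_ge0 // sqrt_fixP.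
by rewrite (le_trans (nrmM _ _)) // ler_wpM2l ?nrm_ge0 // nrmB sqrt_fixP.
Qed.

(* That is, [sqrt ((1 - v)^2) = 1 - v]. *)
Lemma sqrt_fix_sqr v : nrm v <= 1 -> nrm (v + v - v ** v) <= 1 ->
  sqrt_fix (v + v - v ** v) = v.
Proof.
move=> v1 a1; symmetry; apply: (@sqrt_fix_unique _ a1 _ 1) => n.
rewrite mul1r (le_trans _ (sqrt_bound_rate n)) //.
set a := v + v - v ** v; rewrite nrmB.
have comm m : sqrt_iter a m ** v = v ** sqrt_iter a m.
  by apply: sqrt_iter_intertwine; rewrite /a cmulBl cmulDl cmulBr cmulDr cmulA.
(* The error is bounded by 1 - r_n: it is multiplied by (y_n + v)/2, of norm at most (1 + r_n)/2,
   and (1 - r_n)(1 + r_n)/2 = 1 - r_(n+1). *)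
elim: n => /= [|n IH]; first by rewrite sub0r nrmN subr0.
have -> : 2^-1%:C *: (a + sqrt_iter a n ** sqrt_iter a n) - v =
    2^-1%:C *: ((sqrt_iter a n + v) ** (sqrt_iter a n - v)).
  rewrite -sqr_diff // -[X in _ - X = _]scale_half -scalerBr; congr (_ *: _).
  by rewrite /a addrAC (addrAC (v + v)) subrr add0r addrC.
have := nrmM (sqrt_iter a n + v) (sqrt_iter a n - v).
have := nrmD (sqrt_iter a n) v; have := sqrt_iter_bound a1 n.
rewrite nrm_half -/a.
have := sqrt_bound_le1 n.
have := nrm_ge0 (sqrt_iter a n + v); have := nrm_ge0 (sqrt_iter a n - v).
move: (nrm (_ - v)) (nrm (_ + v)) (nrm (_ ** _)) IH v1 => d s p.
move: (nrm (sqrt_iter _ _)) (nrm v) (sqrt_bound n) => q w r *.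
have : d * s <= (1 - r) * (1 + r) by rewrite ler_pM //; lra.
nra.
Qed.

End SquareRootIteration.

(** * Positive elements of a unital C*-algebra *)

Section Positivity.
Variables (R : realType) (U : cstarAlgType R) (e : U).
Hypothesis eP : is_cunit e.
Implicit Types c h k l m p q x y z : U.

Lemma cmul_e x : e ** x = x. Proof. by case: (eP x). Qed.
Lemma cmulr_e x : x ** e = x. Proof. by case: (eP x). Qed.

Lemma selfadj_unit : selfadj e.
Proof. by rewrite /selfadj -{1}[cstar e]cmulr_e -{2}[e]cstarK -cstarM cmulr_e cstarK. Qed.

(** Only an inequality, since in the zero algebra the unit is 0. *)
Lemma nrm_unit_le1 : nrm e <= 1.
Proof.
have := nrm_sqr selfadj_unit; rewrite cmul_e => ee; have := nrm_ge0 e; nra.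
Qed.

(** The square root of [h] when [nrm (e - h) <= 1], the range in which the iteration converges. *)
Definition csqrt h : U := e - sqrt_fix (e - h).

Lemma selfadj_e_sub h : selfadj h -> selfadj (e - h).
Proof. by move=> hs; apply: selfadjB => //; apply: selfadj_unit. Qed.

Lemma csqrt_selfadj h : selfadj h -> nrm (e - h) <= 1 -> selfadj (csqrt h).
Proof.
by move=> hs h1; apply/selfadj_e_sub/sqrt_fix_selfadj => //; apply: selfadj_e_sub.
Qed.

Lemma sqr_e_sub y : (e - y) ** (e - y) = e - (y + y - y ** y).
Proof.
rewrite cmulBl !cmulBr !cmul_e cmulr_e !opprB opprD -!addrA; congr (_ + _).
by rewrite addrCA.
Qed.

Lemma csqrtK h : nrm (e - h) <= 1 -> csqrt h ** csqrt h = h.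
Proof.
by move=> h1; rewrite sqr_e_sub (sqrt_fixE h1) addrK opprB addrC subrK.
Qed.

Lemma csqrt_e_sub h : nrm (e - h) <= 1 -> nrm (e - csqrt h) <= 1.
Proof. by move=> h1; rewrite opprB addrC subrK; exact: sqrt_fix_nrm. Qed.

Lemma csqrt_intertwine h k z : nrm (e - h) <= 1 -> nrm (e - k) <= 1 ->
  h ** z = z ** k -> csqrt h ** z = z ** csqrt k.
Proof.
move=> h1 k1 hz; rewrite /csqrt cmulBl cmulBr cmul_e cmulr_e.
rewrite (@sqrt_fix_intertwine _ _ _ (e - k)) //.
by rewrite cmulBl cmulBr cmul_e cmulr_e hz.
Qed.

Lemma csqrt_sqr k : nrm (e - k) <= 1 -> nrm (e - k ** k) <= 1 ->
  csqrt (k ** k) = k.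
Proof.
set v := e - k => v1; have -> : k = e - v by rewrite opprB addrC subrK.
rewrite /csqrt sqr_e_sub opprB addrC subrK => vv1.
by rewrite sqrt_fix_sqr.
Qed.

(* [(l - i m) (l + i m) = l^2 + m^2] for commuting [l], [m]. *)
Lemma nrm_sum_sqr l m : selfadj l -> selfadj m -> m ** l = l ** m ->
  nrm (l ** l) <= nrm (l ** l + m ** m).
Proof.
move=> ls ms ml; pose u := l + 'i%C *: m.
have uE : cstar u = l - 'i%C *: m.
  rewrite /u cstarD cstarZc ls ms -scaleNr; congr (_ + _ *: _).
  by apply/eqP; rewrite eq_complex /= oppr0 !eqxx.
have ii : 'i%C * 'i%C = -1 :> R[i] by rewrite -expr2 sqr_i.
have uu : cstar u ** u = l ** l + m ** m.
  rewrite uE /u cmulBl !cmulDr !cmulZl !cmulZr ml scalerA ii scaleN1r opprD.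
  by rewrite opprK addrA addrK.
(* [l] is the real part of [u], so its norm is at most that of [u]; the C*-identity then gives the
   claim. *)
have lE : l = 2^-1%:C *: (u + cstar u).
  by rewrite uE /u addrACA subrr addr0 scale_half.
rewrite nrm_sqr // -uu nrm_starM lerXn2r ?nnegrE ?nrm_ge0 //.
rewrite {1}lE nrm_half ler_pdivrMl // (le_trans (nrmD _ _)) // nrm_star.
by rewrite mulr_natl mulr2n.
Qed.

(** k = 1 - h^2 satisfies |1 - k| <= 1, hence has a square root s commuting with h; then |k| = |s^2|
    <= |s^2 + h^2| = |1|. *)
Lemma nrm_e_sub_sqr h : selfadj h -> nrm h <= 1 -> nrm (e - h ** h) <= 1.
Proof.
move=> hs h1.
have h21 : nrm (e - (e - h ** h)) <= 1.
  by rewrite opprB addrC subrK nrm_sqr // expr_le1 ?nrm_ge0.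
have ks : selfadj (e - h ** h) by apply/selfadj_e_sub/selfadj_sqr.
have sh : csqrt (e - h ** h) ** h = h ** csqrt (e - h ** h).
  by apply: csqrt_intertwine => //; rewrite cmulBl cmulBr cmul_e cmulr_e cmulA.
have := nrm_sum_sqr (csqrt_selfadj ks h21) hs (esym sh).
by rewrite csqrtK // subrK => /le_trans; apply; exact: nrm_unit_le1.
Qed.

(* Positivity expressed by the norm, so that no spectral theory is needed and
   stability under sums is immediate. *)
Definition pos h := selfadj h /\ exists2 t : R, 0 <= t & nrm (t%:C *: e - h) <= t.

Lemma pos_near_e h : selfadj h -> nrm (e - h) <= 1 -> pos h.
Proof. by move=> hs h1; split=> //; exists 1; rewrite ?rmorph1 ?scale1r. Qed.

Lemma posD h k : pos h -> pos k -> pos (h + k).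
Proof.
move=> [hs [t t0 ht]] [ks [r r0 kr]]; split; first exact: selfadjD.
exists (t + r); first exact: addr_ge0.
rewrite rmorphD /= scalerDl opprD addrACA (le_trans (nrmD _ _)) //.
exact: lerD.
Qed.

Lemma posZ (a : R) h : 0 <= a -> pos h -> pos (a%:C *: h).
Proof.
move=> a0 [hs [t t0 ht]]; split; first exact: selfadjZ.
exists (a * t); first exact: mulr_ge0.
rewrite rmorphM /= -scalerA -scalerBr nrmZr ger0_norm //.
exact: ler_wpM2l.
Qed.

Lemma scalerVK (a : R) x : a != 0 -> a^-1%:C *: (a%:C *: x) = x.
Proof. by move=> a0; rewrite scalerA -rmorphM /= mulVf // rmorph1 scale1r. Qed.

Lemma pos_sqr h : selfadj h -> pos (h ** h).
Proof.
move=> hs; pose c := nrm h + 1; have c0 : 0 < c by rewrite ltr_wpDl ?nrm_ge0.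
have hE : h = c%:C *: (c^-1%:C *: h).
  by rewrite scalerA -rmorphM /= mulfV ?gt_eqF // rmorph1 scale1r.
set k := c^-1%:C *: h in hE.
have ks : selfadj k by apply: selfadjZ.
have k1 : nrm k <= 1.
  by rewrite nrmZr gtr0_norm ?invr_gt0 // ler_pdivrMl // mulr1 lerDl.
have kp : pos (k ** k).
  by apply: pos_near_e; [exact: selfadj_sqr|exact: nrm_e_sub_sqr].
by rewrite hE cmulZl cmulZr; do 2! (apply: posZ; first exact: ltW).
Qed.

Lemma pos_sqrt h : pos h -> exists s,
  [/\ selfadj s, s ** s = h & forall z, h ** z = z ** h -> s ** z = z ** s].
(* The witness of positivity may be 0; adding 1 keeps the estimate, as the unit has norm at most 1,
   and permits division. *)
Proof.
move=> [hs [t0 t0_ge0 ht0]]; pose t := t0 + 1.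
have t_gt0 : 0 < t by rewrite ltr_wpDl.
have ht : nrm (t%:C *: e - h) <= t.
  rewrite /t rmorphD rmorph1 scalerDl scale1r addrAC.
  by rewrite (le_trans (nrmD _ _)) // lerD // nrm_unit_le1.
pose k := t^-1%:C *: h.
have hE : h = t%:C *: k.
  by rewrite scalerA -rmorphM /= mulfV ?gt_eqF // rmorph1 scale1r.
have k1 : nrm (e - k) <= 1.
  have -> : e - k = t^-1%:C *: (t%:C *: e - h).
    by rewrite scalerBr scalerVK ?gt_eqF.
  by rewrite nrmZr gtr0_norm ?invr_gt0 // ler_pdivrMl // mulr1.
have ks : selfadj k by apply: selfadjZ.
exists ((Num.sqrt t)%:C *: csqrt k); split.
- by apply/selfadjZ/csqrt_selfadj.
- rewrite cmulZl cmulZr scalerA -rmorphM /= -expr2 sqr_sqrtr ?ltW //.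
  by rewrite csqrtK.
- move=> z; rewrite {1 2}hE cmulZl cmulZr => hz.
  rewrite cmulZl cmulZr (@csqrt_intertwine _ k z) //.
  by rewrite /k cmulZl cmulZr hE cmulZl cmulZr hz.
Qed.

(** The square roots of commuting positive elements commute, so [nrm_sum_sqr] applies to them. *)
Lemma pos_nrm_le h k : pos h -> pos k -> h ** k = k ** h ->
  nrm h <= nrm (h + k).
Proof.
move=> /pos_sqrt[l [ls <- lc]] /pos_sqrt[m [ms <- mc]] hk.
apply: nrm_sum_sqr => //.
by apply: mc; rewrite lc.
Qed.

Lemma pos_antisym h : pos h -> pos (- h) -> h = 0.
Proof.
move=> hp hn; apply/nrm0_eq0/le_anti; rewrite nrm_ge0 andbT.
by have := pos_nrm_le hp hn; rewrite subrr nrm0 cmulNl cmulNr; apply.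
Qed.

Lemma pos_e : pos e.
Proof. by rewrite -(cmul_e e); apply/pos_sqr/selfadj_unit. Qed.

(** It forces a functional of norm at most 1 that norms [e + c] to take the values 1 at [e] and
    [nrm c] at [c]. With b = |e + c|, the element b e - (e + c) is positive and commutes with c;
    their sum is (b - 1) e, whence |c| <= b - 1. *)
Lemma pos_nrm_e_add c : pos c -> c != 0 -> 1 + nrm c <= nrm (e + c).
Proof.
move=> cp c0; set b := nrm (e + c).
have [cs _] := cp.
have bp : pos (b%:C *: e - (e + c)).
  split.
    by apply: selfadjB; [apply/selfadjZ|apply/selfadjD => //]; apply: selfadj_unit.
  exists b; first exact: nrm_ge0.
  by rewrite opprB addrC subrK.
have cdE : c + (b%:C *: e - (e + c)) = (b - 1)%:C *: e.
  by rewrite addrC opprD addrA subrK rmorphB rmorph1 scalerBl scale1r.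
have [b1|b1] := leP 1 b.
  have cd : c ** (b%:C *: e - (e + c)) = (b%:C *: e - (e + c)) ** c.
    rewrite cmulBl cmulBr cmulZl cmulZr cmulDl cmulDr.
    by rewrite cmul_e cmulr_e.
  have := pos_nrm_le cp bp cd; rewrite cdE nrmZr ger0_norm ?subr_ge0 //.
  have := nrm_unit_le1; have := nrm_ge0 e; nra.
(* If b < 1, then (1 - b) e and its opposite are both positive; so [e] is 0, against [c != 0]. *)
have b1e : (1 - b)%:C *: e = 0.
  apply: pos_antisym; first by apply: posZ pos_e; rewrite subr_ge0 ltW.
  by rewrite -scaleNr -rmorphN opprB -cdE; apply: posD.
have e0 : e = 0 by rewrite -(@scalerVK (1 - b) e) ?b1e ?scaler0 // subr_eq0 gt_eqF.
by rewrite -(cmul_e c) e0 cmul0l eqxx in c0.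
Qed.

(* If [y^* y] is minus a square, then so is [y y^*]: the absolute values of
   [w = y y^*] and of [y^* y] are intertwined by [y], so that [|w| w = - w^2]. *)
Lemma pos_flip_sqr y g : nrm y <= 1 -> selfadj g -> nrm g <= 1 ->
  cstar y ** y = - (g ** g) -> pos (- (y ** cstar y)).
Proof.
move=> y1 gs g1 yg; set w := y ** cstar y; set k := g ** g in yg.
have ws : selfadj w by rewrite /selfadj cstarM cstarK.
have w1 : nrm w <= 1 by rewrite nrm_starMr expr_le1 ?nrm_ge0.
have ks : selfadj k by apply: selfadj_sqr.
have k1 : nrm k <= 1 by rewrite nrm_sqr // expr_le1 ?nrm_ge0.
have ek1 : nrm (e - k) <= 1 by apply: nrm_e_sub_sqr.
have ekk : nrm (e - k ** k) <= 1 by apply: nrm_e_sub_sqr.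
have eww : nrm (e - w ** w) <= 1 by apply: nrm_e_sub_sqr.
have wy : w ** y = - (y ** k) by rewrite -cmulA yg cmulNr.
have wwy : w ** w ** y = y ** (k ** k).
  by rewrite -cmulA wy cmulNr cmulA wy cmulNl opprK cmulA.
have py : csqrt (w ** w) ** y = y ** k.
  by rewrite (csqrt_intertwine eww ekk wwy) csqrt_sqr.
have pw : csqrt (w ** w) ** w = - (w ** w).
  by rewrite {3}/w cmulA py -[y ** k]opprK -wy cmulNl -cmulA.
have pp := csqrtK eww.
have ps : selfadj (csqrt (w ** w)) by apply: csqrt_selfadj => //; apply: selfadj_sqr.
have wp : w ** csqrt (w ** w) = - (w ** w).
  by rewrite -{1}ws -{1}ps -cstarM pw cstarN cstarM ws.
have p1 := csqrt_e_sub eww.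
move: (csqrt _) pp pw wp ps p1 => p pp pw wp ps p1.
(* Squares and cross terms cancel, so the self-adjoint [p + w] has square 0. *)
have pw0 : p + w = 0.
  apply: selfadj_sqr0; first exact: selfadjD.
  by rewrite cmulDl !cmulDr pp pw wp subrr addNr addr0.
have <- : p = - w by apply/eqP; rewrite -addr_eq0 pw0.
exact: pos_near_e.
Qed.

(** By [pos_flip_sqr] both y^* y and y y^* are negative, while their sum is half a sum of squares of
    self-adjoint elements, hence positive. So y^* y is positive as well as negative. *)
Lemma starM_eqN_sqr y g : nrm y <= 1 -> selfadj g -> nrm g <= 1 ->
  cstar y ** y = - (g ** g) -> y = 0.
Proof.
move=> y1 gs g1 yg; apply: cstarM_eq0.
apply: pos_antisym; last by rewrite yg opprK; apply: pos_sqr.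
pose u := y + cstar y; pose v := 'i%C *: (y - cstar y).
have us : selfadj u by rewrite /selfadj cstarD cstarK addrC.
have vs : selfadj v.
  rewrite /selfadj cstarZc cstarB cstarK /v -opprB scalerN -scaleNr.
  by congr (_ *: _); apply/eqP; rewrite eq_complex /= opprK oppr0 !eqxx.
have vv : v ** v = - ((y - cstar y) ** (y - cstar y)).
  by rewrite cmulZl cmulZr scalerA -expr2 sqr_i scaleN1r.
have uvE : u ** u + v ** v =
    2%:R%:C *: (cstar y ** y + y ** cstar y).
  rewrite vv rmorph_nat scaler_nat mulr2n /u cmulDl cmulBl opprD opprK addrACA.
  rewrite -cmulBr -cmulDr opprD opprK addrACA subrr add0r addrACA subrr addr0.
  by rewrite !cmulDr addrACA (addrC (y ** _)).
have sp : pos (cstar y ** y + y ** cstar y).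
  rewrite -(@scalerVK 2 (_ + _)) // -uvE; apply: posZ => //.
  by apply: posD; apply: pos_sqr.
have := posD sp (pos_flip_sqr y1 gs g1 yg).
by rewrite addrK.
Qed.

(** For a contraction z let h = z^* z, q = |h|, and n = (q - h)/2 the negative part of h. Then h n =
    -n^2, so (z n)^* (z n) = -n^3 is minus a square; hence z n = 0, then n = 0 and h = q. *)
Lemma pos_starM x : pos (cstar x ** x).
Proof.
suff le1 z : nrm z <= 1 -> pos (cstar z ** z).
  pose a := nrm x + 1; have a0 : 0 < a by rewrite ltr_wpDl ?nrm_ge0.
  have xE : x = a%:C *: (a^-1%:C *: x).
    by rewrite scalerA -rmorphM /= mulfV ?gt_eqF // rmorph1 scale1r.
  rewrite xE cstarZr cmulZl cmulZr; do 2! (apply: posZ; first exact: ltW).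
  apply: le1.
  by rewrite nrmZr gtr0_norm ?invr_gt0 // ler_pdivrMl // mulr1 lerDl.
move=> {x} z1; set h := cstar z ** z.
have hs : selfadj h by apply: selfadj_starM.
have h1 : nrm h <= 1 by rewrite nrm_starM expr_le1 ?nrm_ge0.
have ehh : nrm (e - h ** h) <= 1 by apply: nrm_e_sub_sqr.
pose q := csqrt (h ** h).
have qs : selfadj q by apply: csqrt_selfadj => //; apply: selfadj_sqr.
have qq : q ** q = h ** h by apply: csqrtK.
have qh : q ** h = h ** q by apply: csqrt_intertwine => //; rewrite cmulA.
have eq1 : nrm (e - q) <= 1 by apply: csqrt_e_sub.
have q1 : nrm q <= 1.
  by rewrite -(@expr_le1 _ 2) ?nrm_ge0 // -nrm_sqr // qq nrm_sqr // expr_le1 ?nrm_ge0.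
clearbody q; pose n := 2^-1%:C *: (q - h).
have ns : selfadj n by apply/selfadjZ/selfadjB.
have n1 : nrm n <= 1.
  rewrite nrm_half ler_pdivrMl // (le_trans (nrmD _ _)) // nrmN; lra.
have hn : h ** n = - (n ** n).
  have sq : (q - h) ** (q - h) = - (h ** (q - h) + h ** (q - h)).
    have hq : q ** (q - h) = - (h ** (q - h)) by rewrite !cmulBr qq qh opprB.
    by rewrite cmulBl hq opprD.
  by rewrite /n !cmulZl !cmulZr sq !scalerN opprK scale_half.
have qn : q ** n = n ** q by rewrite /n cmulZl cmulZr cmulBl cmulBr qh.
have qnn : q ** n = n ** n.
  have -> : q = n + n + h by rewrite /n -scalerDr scale_half subrK.
  by rewrite !cmulDl hn addrK.
(* As q n = n^2, this plays the role of n^(3/2); the root of [q] exists because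
   [nrm (e - q) <= 1]. *)
pose g := csqrt q ** n.
have sn : csqrt q ** n = n ** csqrt q by apply: csqrt_intertwine.
have ss : selfadj (csqrt q) by apply: csqrt_selfadj.
have gs : selfadj g by apply: selfadjM.
have gg : g ** g = n ** n ** n.
  by rewrite /g {1}sn -cmulA (cmulA _ _ n) csqrtK // qnn cmulA.
have g1 : nrm g <= 1.
  rewrite (le_trans (nrmM _ _)) // mulr_ile1 ?nrm_ge0 //.
  by rewrite -(@expr_le1 _ 2) ?nrm_ge0 // -nrm_sqr // csqrtK.
have zn : z ** n = 0.
  apply: (@starM_eqN_sqr _ g) => //.
    by rewrite (le_trans (nrmM _ _)) // mulr_ile1 ?nrm_ge0.
  rewrite gg cstarM ns -cmulA (cmulA (cstar z)) -/h hn cmulNr cmulA //.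
have nn : n ** n = 0.
  by apply/eqP; rewrite -oppr_eq0 -hn /h -cmulA zn cmul0r.
have n0 : n = 0 by apply: selfadj_sqr0.
have <- : q = h.
  apply/eqP; rewrite -subr_eq0 -(scale_half (q - h)) scalerDr -/n n0 addr0.
  by [].
exact: pos_near_e.
Qed.

End Positivity.

(** * The Hahn-Banach theorem for the norm *)

Section HahnBanach.
Variables (R : realType) (V : normedModType R[i]) (v0 : V).
Implicit Types (v w : V) (r s t : R) (G : set (V * R)).

(* Graphs of partial real-linear functionals dominated by the norm; domination
   makes a linear graph single-valued. *)
Definition dominated_graph G :=
  [/\ forall v r w s t, G (v, r) -> G (w, s) -> G (t%:C *: v + w, t * r + s),
      forall v r, G (v, r) -> r <= nrm v &
      forall v r, G (v, r) -> G (v0, nrm v0)].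

(** Zorn's lemma includes the empty chain, whose union is empty. The last clause of
    [dominated_graph] is conditional in order to admit it. *)
Lemma dominated_graph_max : exists G, dominated_graph G /\
  forall G', G `<` G' -> ~ dominated_graph G'.
Proof.
apply: Zorn_bigcup => F FP Ftot; split.
- move=> v r w s t [G1 FG1 G1v] [G2 FG2 G2w].
  have [G12|G21] := Ftot _ _ FG1 FG2.
    exists G2 => //; have [lin _ _] := FP _ FG2.
    by apply: lin => //; apply: G12.
  exists G1 => //; have [lin _ _] := FP _ FG1.
  by apply: lin => //; apply: G21.
- by move=> v r [G FG Gv]; have [_ dom _] := FP _ FG; apply: dom.
- move=> v r [G FG Gv]; exists G => //; have [_ _ h] := FP _ FG; exact: h Gv.
Qed.

Section Extension.
Variables (G : set (V * R)) (G0 : G (0, 0)) (GP : dominated_graph G) (u : V).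

Let Gl v r w s t : G (v, r) -> G (w, s) -> G (t%:C *: v + w, t * r + s).
Proof. by have [lin _ _] := GP; apply: lin. Qed.

Let Gd v r : G (v, r) -> r <= nrm v.
Proof. by have [_ dom _] := GP; apply: dom. Qed.

(** The one-dimensional step of Hahn-Banach: [c] is the supremum of r - |v - u|, bounded by each |w
    + u| - s since r + s <= |v + w| <= |v - u| + |w + u|. *)
Lemma extension_value : exists c, forall v r, G (v, r) ->
  r + c <= nrm (v + u) /\ r - c <= nrm (v - u).
Proof.
pose S := [set z | exists v r, G (v, r) /\ z = r - nrm (v - u)].
have Sub w s : G (w, s) -> ubound S (nrm (w + u) - s).
  move=> Gw _ [v [r [Gv ->]]].
  have := Gd (Gl 1 Gv Gw); rewrite rmorph1 scale1r mul1r.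
  have := nrmD (v - u) (w + u); rewrite addrACA addNr addr0; lra.
have S0 : S !=set0 by exists (0 - nrm (0 - u)); exists 0, 0.
exists (sup S) => v r Gv; split.
  by rewrite addrC -lerBrDr; apply: ge_sup => //; apply: Sub.
rewrite lerBlDr addrC -lerBlDr; apply: ub_le_sup; last by exists v, r.
by exists (nrm (0 + u) - 0); apply: Sub.
Qed.

Definition graph_ext c : set (V * R) :=
  [set z | exists v r t, G (v, r) /\ z = (v + t%:C *: u, r + t * c)].

(** Homogeneity reduces domination to t = 1. Negative multiples of [u] are covered by taking [- c]
    and [- u]. *)
Lemma scaled_dom (c : R) w t v r : 0 < t -> G (v, r) ->
  (forall v r, G (v, r) -> r + c <= nrm (v + w)) ->
  r + t * c <= nrm (v + t%:C *: w).
Proof.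
move=> t0 Gv /(_ _ _ (Gl t^-1 Gv G0)); rewrite !addr0 => le.
have tt : t%:C * t^-1%:C = 1 by rewrite -rmorphM /= mulfV ?gt_eqF.
rewrite -[v]scale1r -tt -scalerA -scalerDr nrmZr gtr0_norm //.
by rewrite -(mulVKf (lt0r_neq0 t0) r) -mulrDr ler_pM2l.
Qed.

Lemma dominated_graph_ext : exists c, dominated_graph (graph_ext c).
Proof.
have [c cP] := extension_value; exists c; split.
- move=> _ _ _ _ t [v [r [a [Gv [-> ->]]]]] [w [s [b [Gw [-> ->]]]]].
  exists (t%:C *: v + w), (t * r + s), (t * a + b); split; first exact: Gl.
  congr (_, _); last ring.
  by rewrite scalerDr scalerA addrACA rmorphD rmorphM scalerDl.
- move=> _ _ [v [r [t [Gv [-> ->]]]]].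
  have [t0|t0|->] := ltgtP t 0; last by rewrite scale0r mul0r !addr0 Gd.
    have := @scaled_dom (- c) (- u) (- t) v r; rewrite oppr_gt0 => /(_ t0 Gv).
    rewrite mulrNN rmorphN scalerN scaleNr opprK; apply => w s Gw.
    by have [] := cP _ _ Gw.
  by apply: scaled_dom => // w s Gw; have [] := cP _ _ Gw.
- move=> _ _ [v [r [t [Gv _]]]]; exists v0, (nrm v0), 0.
  rewrite scale0r mul0r !addr0; split => //.
  by have [_ _ h] := GP; exact: h Gv.
Qed.

End Extension.

Lemma dominated_graph_line :
  dominated_graph [set z | exists t, z = (t%:C *: v0, t * nrm v0)].
Proof.
split.
- move=> _ _ _ _ t [a [-> ->]] [b [-> ->]]; exists (t * a + b).
  by rewrite scalerA rmorphD rmorphM scalerDl mulrDl mulrA.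
- by move=> _ _ [t [-> ->]]; rewrite nrmZr ler_wpM2r ?nrm_ge0 // ler_norm.
- by move=> *; exists 1; rewrite rmorph1 scale1r mul1r.
Qed.

Lemma norming_functional : exists g : V -> R,
  [/\ forall t v w, g (t%:C *: v + w) = t * g v + g w,
      forall v, g v <= nrm v & g v0 = nrm v0].
Proof.
have [G [GP Gmax]] := dominated_graph_max.
have [Gl Gd Gv0] := GP.
(* A maximal graph is not empty, because the line through [v0] would be larger. *)
have [v1 [r1 G1]] : exists v r, G (v, r).
  apply: contrapT => G_empty.
  apply: (Gmax _ _ dominated_graph_line); split.
    by move=> [v r] Gv; case: G_empty; exists v, r.
  move=> sub; apply: G_empty; exists v0, (nrm v0); apply: sub.
  by exists 1; rewrite rmorph1 scale1r mul1r.
have G0 : G (0, 0).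
  have := Gl _ _ _ _ (-1) G1 G1.
  by rewrite rmorphN rmorph1 scaleN1r mulN1r !addNr.
have Gtot v : exists c, G (v, c).
  have [c cP] := dominated_graph_ext G0 GP v; exists c.
  apply: contrapT => Gvc; apply: (Gmax _ _ cP); split.
    move=> [w r] Gw; exists w, r, 0; split => //.
    by rewrite scale0r mul0r !addr0.
  move=> /(_ (v, c)) Gvc'; apply: Gvc; apply: Gvc'.
  by exists 0, 0, 1; rewrite rmorph1 scale1r mul1r !add0r.
have [g gP] := choice Gtot.
have G_fun v r s : G (v, r) -> G (v, s) -> r = s.
  move=> Gr Gs; apply/le_anti.
  have := Gd _ _ (Gl _ _ _ _ (-1) Gr Gs); have := Gd _ _ (Gl _ _ _ _ (-1) Gs Gr).
  rewrite rmorphN rmorph1 scaleN1r addNr nrm0; lra.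
exists g; split.
- by move=> t v w; apply: G_fun (gP _) _; apply: Gl.
- by move=> v; apply: Gd.
- by apply: G_fun (gP _) _; apply: Gv0 G1.
Qed.

End HahnBanach.

(** * Adjointable operators *)

(* A form standing for an inner product: it may be vector-valued, so as to
   cover both Hilbert spaces and [(x, y) |-> x^* y] on a C*-algebra. *)
Record pairing (R : realType) (H W : normedModType R[i]) := Pairing {
  form :> H -> H -> W;
  form_conj : W -> W;
  formC : forall x y, form y x = form_conj (form x y);
  formDl : forall x y z, form (x + y) z = form x z + form y z;
  formDr : forall x y z, form x (y + z) = form x y + form x z;
  formZl : forall (k : R[i]) x y, form (k *: x) y = conjc k *: form x y;
  formZr : forall (k : R[i]) x y, form x (k *: y) = k *: form x y;
  form_le : forall x y, nrm (form x y) <= nrm x * nrm y;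
  form_nrm : forall x, nrm (form x x) = nrm x ^+ 2
}.

Section AdjointableOperators.
Variables (R : realType) (H : completeNormedModType R[i]).
Variables (W : normedModType R[i]) (p : pairing H W).
Implicit Types (x y z : H) (S T : H -> H).

Lemma formNl x y : p (- x) y = - p x y.
Proof. by rewrite -scaleN1r formZl rmorphN rmorph1 scaleN1r. Qed.

Lemma formNr x y : p x (- y) = - p x y.
Proof. by rewrite -scaleN1r formZr scaleN1r. Qed.

Lemma form0r x : p x 0 = 0.
Proof. by rewrite -(scale0r 0) formZr scale0r. Qed.

Lemma form0l x : p 0 x = 0.
Proof. by rewrite -(scale0r 0) formZl conjc0 scale0r. Qed.

Lemma form_inj x y : (forall z, p x z = p y z) -> x = y.
Proof.
move=> xy; apply/eqP; rewrite -subr_eq0; apply/eqP/nrm0_eq0/eqP.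
by rewrite -(@sqrf_eq0 R) -(form_nrm p) formDl formNl xy subrr nrm0.
Qed.

Definition is_adjoint T S := forall x y, p (T x) y = p x (S y).

Definition op_bound T (M : R) := 0 <= M /\ forall x, nrm (T x) <= M * nrm x.

Lemma is_adjointC T S : is_adjoint T S -> is_adjoint S T.
Proof. by move=> TS x y; rewrite formC -TS -formC. Qed.

Lemma is_adjoint_uniq T S S' : is_adjoint T S -> is_adjoint T S' -> S = S'.
Proof.
move=> TS TS'; apply/funext => y; apply: form_inj => z.
by rewrite (is_adjointC TS) (is_adjointC TS').
Qed.

(** |S y|^2 = |p (T (S y)) y| <= M |S y| |y|, and |S y| cancels. *)
Lemma adjoint_bound T S M : is_adjoint T S -> op_bound T M -> op_bound S M.
Proof.
move=> TS [M0 TM]; split=> // y.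
have [->|Sy0] := eqVneq (nrm (S y)) 0; first by rewrite mulr_ge0 ?nrm_ge0.
have Sy : 0 < nrm (S y) by rewrite lt_def Sy0 nrm_ge0.
rewrite -(ler_pM2r Sy) -expr2 -(form_nrm p) -TS.
rewrite (le_trans (form_le _ _ _)) // mulrAC ler_wpM2r ?nrm_ge0 //.
Qed.

Lemma adjoint_linear T S k x y : is_adjoint T S ->
  T (k *: x + y) = k *: T x + T y.
Proof. by move=> TS; apply: form_inj => z; rewrite !(TS, formDl, formZl). Qed.

Definition adjointable : {pred H -> H} :=
  [pred T | `[< (exists M, op_bound T M) /\ exists S, is_adjoint T S >]].

Lemma adjointable_submod : GRing.submod_closed adjointable.
Proof.
split.
  apply/asboolP; split; first by exists 0; split=> // x; rewrite nrm0 mul0r.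
  by exists (fun _ => 0) => x y; rewrite form0l form0r.
move=> k T1 T2 /asboolP[[M1 [M10 T1M]] [S1 TS1]] /asboolP[[M2 [M20 T2M]] [S2 TS2]].
apply/asboolP; split.
  exists (nrm (k : R[i]^o) * M1 + M2); split.
    by rewrite addr_ge0 // mulr_ge0 // nrm_ge0.
  move=> x; rewrite (le_trans (nrmD _ _)) // mulrDl lerD // nrmZ -mulrA.
  by rewrite ler_wpM2l // nrm_ge0.
exists (fun y => conjc k *: S1 y + S2 y) => x y.
by rewrite formDl formZl TS1 TS2 formDr formZr.
Qed.

(** The adjoint is not stored, so that equality of operators is equality of functions; [adjop_star]
    recovers it by choice, and it is unique. *)
Record adjop := Adjop { adjop_fun :> H -> H; _ : adjop_fun \in adjointable }.

End AdjointableOperators.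

Section AdjopInstances.
Variables (R : realType) (H : completeNormedModType R[i]).
Variables (W : normedModType R[i]) (p : pairing H W).
Implicit Types (x y z : H).

HB.instance Definition _ := GRing.isSubmodClosed.Build R[i] (H -> H)
  (adjointable p) (adjointable_submod p).
HB.instance Definition _ := [isSub for (@adjop_fun R H W p)].
HB.instance Definition _ := [Choice of adjop p by <:].
HB.instance Definition _ := [SubChoice_isSubLmodule of adjop p by <:].

Implicit Types (S T : adjop p).

Lemma adjopP T T' : (T : H -> H) =1 T' -> T = T'.
Proof. by move=> TT; apply/val_inj/funext. Qed.

Lemma adjopD T T' x : (T + T') x = T x + T' x. Proof. by []. Qed.
Lemma adjopN T x : (- T) x = - T x. Proof. by []. Qed.
Lemma adjopZ (k : R[i]) T x : (k *: T) x = k *: T x. Proof. by []. Qed.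

Lemma adjopVP T : exists S : adjop p, is_adjoint p T S.
Proof.
case: T => T /= TP; have /asboolP[[M TM] [S TS]] := TP.
have SP : S \in adjointable p.
  apply/asboolP; split; first by exists M; exact: adjoint_bound TS TM.
  by exists T; apply: is_adjointC.
by exists (Adjop SP).
Qed.

Lemma adjop_linear T (k : R[i]) x y : T (k *: x + y) = k *: T x + T y.
Proof. by have [S TS] := adjopVP T; exact: adjoint_linear TS. Qed.

Lemma adjop0 T : T 0 = 0.
Proof. by have := adjop_linear T (-1) 0 0; rewrite scaler0 addr0 scaleN1r addNr. Qed.

Lemma adjop_scale T (k : R[i]) x : T (k *: x) = k *: T x.
Proof. by have := adjop_linear T k x 0; rewrite adjop0 !addr0. Qed.

Lemma adjop_add T x y : T (x + y) = T x + T y.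
Proof. by have := adjop_linear T 1 x y; rewrite !scale1r. Qed.

Lemma adjop_sub T x y : T (x - y) = T x - T y.
Proof. by rewrite adjop_add -(scaleN1r y) adjop_scale scaleN1r. Qed.

(** As an infimum of bounds it needs no exception for H = 0, unlike a supremum over unit vectors. *)
Definition opnorm T : R := inf [set M | op_bound T M].

Lemma op_bounds_lb T : has_lbound [set M | op_bound T M].
Proof. by exists 0 => M []. Qed.

Lemma op_bounds_neq0 T : [set M | op_bound T M] !=set0.
Proof. by case: T => T TP; have /asboolP[[M TM] _] := TP; exists M. Qed.

Lemma opnorm_ge0 T : 0 <= opnorm T.
Proof. by apply: lb_le_inf (op_bounds_neq0 T) _ => M []. Qed.

Lemma opnorm_le T M : op_bound T M -> opnorm T <= M.
Proof. by move=> TM; apply: ge_inf => //; exact: op_bounds_lb. Qed.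

Lemma nrm_adjop T x : nrm (T x) <= opnorm T * nrm x.
Proof.
have [x0|x0] := eqVneq (nrm x) 0.
  by rewrite (nrm0_eq0 x0) adjop0 nrm0 mulr0.
have x_gt0 : 0 < nrm x by rewrite lt_def x0 nrm_ge0.
rewrite -ler_pdivrMr //; apply: lb_le_inf (op_bounds_neq0 T) _ => M [_ TM].
by rewrite ler_pdivrMr.
Qed.

Lemma opnormP T : op_bound T (opnorm T).
Proof. by split; [exact: opnorm_ge0|exact: nrm_adjop]. Qed.

Definition adjop_norm T : R[i] := (opnorm T)%:C.

Lemma adjop_normD S T : adjop_norm (S + T) <= adjop_norm S + adjop_norm T.
Proof.
rewrite /adjop_norm -rmorphD lecR; apply: opnorm_le; split.
  by rewrite addr_ge0 // opnorm_ge0.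
move=> x; rewrite adjopD (le_trans (nrmD _ _)) // mulrDl.
by rewrite lerD // nrm_adjop.
Qed.

Lemma adjop_normZ (k : R[i]) T : adjop_norm (k *: T) = `|k| * adjop_norm T.
Proof.
have le (j : R[i]) (S : adjop p) : opnorm (j *: S) <= nrm (j : R[i]^o) * opnorm S.
  apply: opnorm_le; split; first by rewrite mulr_ge0 ?nrm_ge0 ?opnorm_ge0.
  by move=> x; rewrite adjopZ nrmZ -mulrA ler_wpM2l ?nrm_ge0 // nrm_adjop.
rewrite /adjop_norm -[`|k|]/(`|k : R[i]^o|) nrmE -rmorphM; congr (_%:C).
apply/le_anti; rewrite le /=.
have [->|k0] := eqVneq k 0.
  by rewrite nrm0 mul0r opnorm_ge0.
have kn0 : 0 < nrm (k : R[i]^o).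
  by rewrite lt_def nrm_ge0 andbT; apply: contra k0 => /eqP/nrm0_eq0 ->.
rewrite -ler_pdivlMl // -{1}[T](scalerK k0) (le_trans (le _ _)) //.
rewrite ler_wpM2r ?opnorm_ge0 //.
by rewrite /nrm normfV -[`|k|]/(`|k : R[i]^o|) nrmE -fmorphV.
Qed.

Lemma adjop_norm0_eq0 T : adjop_norm T = 0 -> T = 0.
Proof.
move=> /complexI T0; apply: adjopP => x; apply/nrm0_eq0/le_anti.
by rewrite nrm_ge0 andbT (le_trans (nrm_adjop _ _)) // T0 mul0r.
Qed.

HB.instance Definition _ := @Lmodule_isNormed.Build R[i] (adjop p)
  adjop_norm adjop_normD adjop_normZ adjop_norm0_eq0.

End AdjopInstances.

Section AdjopComplete.
Variables (R : realType) (H : completeNormedModType R[i]).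
Variables (W : normedModType R[i]) (p : pairing H W).
Implicit Types (x y z : H) (S T : adjop p).

Definition adjop_star T : adjop p := projT1 (cid (adjopVP T)).

Lemma adjop_starP T : is_adjoint p T (adjop_star T).
Proof. exact: (projT2 (cid (adjopVP T))). Qed.

Lemma adjop_star_uniq T S : is_adjoint p T S -> adjop_star T = S.
Proof. by move=> TS; apply/val_inj/(is_adjoint_uniq (adjop_starP T) TS). Qed.

Lemma adjop_starK : involutive adjop_star.
Proof. by move=> T; apply/adjop_star_uniq/is_adjointC/adjop_starP. Qed.

Lemma adjop_starD S T : adjop_star (S + T) = adjop_star S + adjop_star T.
Proof.
apply: adjop_star_uniq => x y.
by rewrite !adjopD formDl formDr !adjop_starP.
Qed.

Lemma adjop_starZ (k : R[i]) T : adjop_star (k *: T) = conjc k *: adjop_star T.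
Proof.
by apply: adjop_star_uniq => x y; rewrite !adjopZ formZl formZr adjop_starP.
Qed.

Lemma nrm_opnorm T : nrm T = opnorm T. Proof. by []. Qed.

Lemma opnorm_star T : opnorm (adjop_star T) = opnorm T.
Proof.
apply/le_anti/andP; split; apply: opnorm_le.
  exact: adjoint_bound (adjop_starP T) (opnormP T).
exact: adjoint_bound (is_adjointC (adjop_starP T)) (opnormP _).
Qed.

(** The limit is left a bare map. Applying this to the filter of adjoints as well provides its
    adjoint. *)
Lemma adjop_pointwise_lim (G : set_system (adjop p)) : ProperFilter G ->
  (forall e, 0 < e -> exists T0, G [set T | opnorm (T0 - T) < e]) ->
  exists L : H -> H,
    forall e, 0 < e -> G [set T | forall x, nrm (L x - T x) <= e * nrm x].
Proof.
move=> GG Gc.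
have lim x : exists l, forall e, 0 < e -> G [set T | nrm (l - T x) < e].
  apply: (@complete_nrm _ H ((fun T : adjop p => T x) @ G)) => e e0.
  have x0 : 0 < nrm x + 1 by rewrite ltr_wpDl ?nrm_ge0.
  have [T0 GT0] := Gc _ (divr_gt0 e0 x0); exists (T0 x).
  rewrite /fmap /=; apply: filterS GT0 => T /= T0T.
  have := nrm_adjop (T0 - T) x; move: T0T; rewrite adjopD adjopN ltr_pdivlMr //.
  have := opnorm_ge0 (T0 - T); have := nrm_ge0 x; nra.
have [L LP] := choice lim; exists L => e e0.
have [T0 GT0] := Gc _ (divr_gt0 e0 (ltr0n _ 2)).
apply: filterS (GT0) => T /= T0T x; rewrite leNgt; apply/negP => lt.
have /(LP x) GL : 0 < nrm (L x - T x) - e * nrm x by rewrite subr_gt0.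
have [T1 /= [T1L]] := filter_ex (filterI GL GT0); rewrite /= => T0T1.
have := nrm_adjop (T0 - T) x; have := nrm_adjop (T0 - T1) x.
rewrite !adjopD !adjopN.
have := nrm_sub_trans (T1 x) (L x) (T x); have := nrm_sub_trans (T0 x) (T1 x) (T x).
rewrite (nrmB (T1 x) (T0 x)) => tr1 tr2 b1 b2.
have : opnorm (T0 - T) * nrm x <= e / 2 * nrm x by rewrite ler_wpM2r ?nrm_ge0 // ltW.
have : opnorm (T0 - T1) * nrm x <= e / 2 * nrm x by rewrite ler_wpM2r ?nrm_ge0 // ltW.
lra.
Qed.

Lemma adjop_complete (F : set_system (adjop p)) :
  ProperFilter F -> cauchy F -> cvg F.
Proof.
move=> FF Fc.
have [|L LP] := @adjop_pointwise_lim F _; first exact: cauchy_nrm.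
have [|K KP] := @adjop_pointwise_lim (adjop_star @ F) _.
  move=> e /(cauchy_nrm FF Fc)[T0 FT0]; exists (adjop_star T0).
  rewrite /fmap /=; apply: filterS FT0 => T /=; rewrite nrm_opnorm.
  by rewrite -(opnorm_star (T0 - T)) -scaleN1r adjop_starD adjop_starZ
    rmorphN rmorph1 scaleN1r.
rewrite /fmap /= in KP.
have LK : is_adjoint p L K.
  move=> x y; apply/eqP; rewrite -subr_eq0; apply/eqP/nrm0_eq0/le_anti.
  rewrite nrm_ge0 andbT leNgt; apply/negP => lt.
  (* Replacing [L] and [K] by [T] and its adjoint costs at most 2 e |x| |y|, which for this [e] is
     less than the distance to be excluded. *)
  pose e := nrm (p (L x) y - p x (K y)) / (2 * nrm x * nrm y + 1).
  have xy0 : 0 < 2 * nrm x * nrm y + 1.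
    by rewrite ltr_wpDl // !mulr_ge0 // nrm_ge0.
  have e0 : 0 < e by rewrite divr_gt0.
  have [T [/(_ x) LT /(_ y) KT]] := filter_ex (filterI (LP _ e0) (KP _ e0)).
  have eE : e * (2 * nrm x * nrm y + 1) = nrm (p (L x) y - p x (K y)).
    by rewrite /e divfK // gt_eqF.
  have := nrm_sub_trans (p (T x) y) (p (L x) y) (p x (K y)).
  rewrite -eE {2}(adjop_starP T) -[- p (T x) y]formNl -formDl.
  rewrite -[- p x (K y)]formNr -formDr.
  have := form_le p (L x - T x) y; have := form_le p x (adjop_star T y - K y).
  rewrite (nrmB (adjop_star T y)).
  have := nrm_ge0 x; have := nrm_ge0 y.
  move: (nrm (p _ _)) (nrm (p _ _)) => a b y0 x0 Ha Hb Hab.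
  have : nrm x * nrm (K y - adjop_star T y) <= nrm x * (e * nrm y).
    by rewrite ler_wpM2l.
  have : nrm (L x - T x) * nrm y <= e * nrm x * nrm y by rewrite ler_wpM2r.
  lra.
have Lb : exists M, op_bound L M.
  have [T /= LT] := filter_ex (LP _ ltr01); exists (1 + opnorm T); split.
    by rewrite addr_ge0 // opnorm_ge0.
  move=> x; rewrite -(subrK (T x) (L x)) (le_trans (nrmD _ _)) // mulrDl.
  by rewrite lerD ?LT ?nrm_adjop.
have LA : L \in adjointable p by apply/asboolP; split=> //; exists K.
apply/cvg_ex; exists (Adjop LA); apply/cvg_nrmP => e e0.
have e20 : 0 < e / 2 by rewrite divr_gt0.
apply: filterS (LP _ e20) => T /= LT.
apply: (@le_lt_trans _ _ (e / 2)); last by rewrite ltr_pdivrMr // ltr_pMr // ltr1n.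
apply: opnorm_le; split; first exact: ltW.
by move=> x; rewrite adjopD adjopN.
Qed.

HB.instance Definition _ := Uniform_isComplete.Build (adjop p) adjop_complete.

Lemma adjop_compP S T : ((S : H -> H) \o T) \in adjointable p.
Proof.
apply/asboolP; split.
  exists (opnorm S * opnorm T); split; first by rewrite mulr_ge0 ?opnorm_ge0.
  move=> x /=; rewrite (le_trans (nrm_adjop _ _)) // -mulrA.
  by rewrite ler_wpM2l ?opnorm_ge0 // nrm_adjop.
exists (adjop_star T \o adjop_star S) => x y /=.
by rewrite !adjop_starP.
Qed.

Definition adjop_comp S T : adjop p := Adjop (adjop_compP S T).

Lemma adjop_starM S T :
  adjop_star (adjop_comp S T) = adjop_comp (adjop_star T) (adjop_star S).
Proof. by apply: adjop_star_uniq => x y /=; rewrite !adjop_starP. Qed.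

Lemma opnorm_comp S T : opnorm (adjop_comp S T) <= opnorm S * opnorm T.
Proof.
apply: opnorm_le; split; first by rewrite mulr_ge0 ?opnorm_ge0.
move=> x /=; rewrite (le_trans (nrm_adjop _ _)) // -mulrA.
by rewrite ler_wpM2l ?opnorm_ge0 // nrm_adjop.
Qed.

Lemma opnorm_starM T : opnorm (adjop_comp (adjop_star T) T) = opnorm T ^+ 2.
Proof.
apply/le_anti/andP; split.
  by rewrite (le_trans (opnorm_comp _ _)) // opnorm_star.
set M := opnorm (adjop_comp _ _); have M0 : 0 <= M by apply: opnorm_ge0.
rewrite -(sqr_sqrtr M0) lerXn2r ?nnegrE ?opnorm_ge0 ?sqrtr_ge0 //.
apply: opnorm_le; split; first exact: sqrtr_ge0.
move=> x; rewrite -(@ler_pXn2r _ 2) ?nnegrE ?mulr_ge0 ?nrm_ge0 ?sqrtr_ge0 //.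
rewrite exprMn sqr_sqrtr // -(form_nrm p) adjop_starP.
rewrite (le_trans (form_le _ _ _)) // expr2 mulrCA ler_wpM2l ?nrm_ge0 //.
exact: (nrm_adjop (adjop_comp (adjop_star T) T)).
Qed.

Let mulA : associative adjop_comp.
Proof. by move=> S T T'; apply: adjopP. Qed.

Let mulDl : left_distributive adjop_comp +%R.
Proof. by move=> S T T'; apply: adjopP. Qed.

Let mulDr : right_distributive adjop_comp +%R.
Proof. by move=> S T T'; apply: adjopP => x /=; rewrite adjop_add. Qed.

Let mulZl (k : R[i]) S T : adjop_comp (k *: S) T = k *: adjop_comp S T.
Proof. exact: adjopP. Qed.

Let mulZr (k : R[i]) S T : adjop_comp S (k *: T) = k *: adjop_comp S T.
Proof. by apply: adjopP => x /=; rewrite adjop_scale. Qed.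

Let normM S T : `|adjop_comp S T| <= `|S| * `|T|.
Proof. by rewrite !nrmE -rmorphM lecR; exact: opnorm_comp. Qed.

Let norm_starM T : `|adjop_comp (adjop_star T) T| = `|T| ^+ 2.
Proof. by rewrite !nrmE -rmorphXn; congr (_%:C); exact: opnorm_starM. Qed.

HB.instance Definition _ := @isCStarAlgebra.Build R (adjop p)
  adjop_comp adjop_star mulA mulDl mulDr mulZl mulZr adjop_starD adjop_starZ
  adjop_starM adjop_starK normM norm_starM.

Definition adjop1 : adjop p.
Proof.
exists idfun; apply/asboolP; split; last by exists idfun.
by exists 1; split=> // x; rewrite mul1r.
Defined.

Lemma adjop1_unit : is_cunit adjop1.
Proof. by move=> T; split; apply: adjopP. Qed.

End AdjopComplete.

(** * Hilbert space completion *)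

(** Null vectors are allowed, as a GNS form need not be definite; symmetry already makes the
    diagonal values real. *)
Record semi_inner (R : realType) (X : lmodType R[i]) := SemiInner {
  sip :> X -> X -> R[i]^o;
  sipC : forall x y, sip y x = conjc (sip x y);
  sipDr : forall x y z, sip x (y + z) = sip x y + sip x z;
  sipZr : forall (k : R[i]) x y, sip x (k *: y) = k *: sip x y;
  sip_ge0 : forall x, 0 <= complex.Re (sip x x)
}.

Section SemiInner.
Variables (R : realType) (X : lmodType R[i]) (s : semi_inner X).
Implicit Types (x y z : X) (k : R[i]).

Lemma nrm_conjc (k : R[i]) : nrm (conjc k : R[i]^o) = nrm (k : R[i]^o).
Proof. by congr complex.Re; exact: normcJ. Qed.

Lemma nrm_sqr_complex (k : R[i]) : (nrm (k : R[i]^o) ^+ 2)%:C = k * conjc k.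
Proof. by rewrite rmorphXn /= -nrmE sqr_normc. Qed.

Lemma Re_le_nrm (k : R[i]) : complex.Re k <= nrm (k : R[i]^o).
Proof.
rewrite (le_trans (ler_norm _)) // -lecR -nrmE; exact: normc_ge_Re.
Qed.

Lemma sipDl x y z : s (x + y) z = s x z + s y z.
Proof. by rewrite !(sipC s z) sipDr rmorphD. Qed.

Lemma sipZl k x y : s (k *: x) y = conjc k *: s x y.
Proof. by rewrite !(sipC s y) sipZr rmorphM. Qed.

Lemma sip0r x : s x 0 = 0.
Proof. by rewrite -(scale0r x) sipZr scale0r. Qed.

Lemma sipBr x y z : s x (y - z) = s x y - s x z.
Proof. by rewrite sipDr -scaleN1r sipZr scaleN1r. Qed.

Lemma sipBl x y z : s (x - y) z = s x z - s y z.
Proof. by rewrite !(sipC s z) sipBr rmorphB. Qed.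

Definition snrm x : R := Num.sqrt (complex.Re (s x x)).

Lemma snrm_ge0 x : 0 <= snrm x. Proof. exact: sqrtr_ge0. Qed.

Lemma snrm_sqr x : snrm x ^+ 2 = complex.Re (s x x).
Proof. by rewrite sqr_sqrtr // sip_ge0. Qed.

Lemma sip_self x : s x x = (snrm x ^+ 2)%:C.
Proof.
rewrite snrm_sqr; have := sipC s x x.
by case: (s x x) => a b [/= /eqP]; rewrite -addr_eq0 -mulr2n mulrn_eq0 /= => /eqP ->.
Qed.

Lemma nrm_sip_self x : nrm (s x x) = snrm x ^+ 2.
Proof.
by rewrite sip_self /nrm normc_def /= expr0n /= addr0 sqrtr_sqr ger0_norm ?sqr_ge0.
Qed.

Lemma cauchy_schwarz x y : nrm (s x y) <= snrm x * snrm y.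
Proof.
set z := s x y; set n := nrm z; have n0 : 0 <= n := nrm_ge0 _.
(* The factor conj z makes the cross terms real, so that positivity at x - t (conj z) y is a real
   quadratic inequality in t. *)
have key (t : R) : 0 <= snrm x ^+ 2 - 2 * t * n ^+ 2 + t ^+ 2 * n ^+ 2 * snrm y ^+ 2.
  have := sip_ge0 s (x - (t%:C * conjc z) *: y).
  rewrite sipBr !sipBl !sipZr !sipZl (sipC s x y) -/z !sip_self.
  rewrite -![_ *: _]/(_ * _ : R[i]).
  rewrite (_ : complex.Re _ = snrm x ^+ 2 - 2 * t * n ^+ 2 +
     t ^+ 2 * n ^+ 2 * snrm y ^+ 2) //.
  have /(congr1 (@complex.Re R)) /= -> := nrm_sqr_complex z.
  by case: (z) => a b /=; ring.
have a0 := snrm_ge0 x; have b0 := snrm_ge0 y.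
rewrite -(@ler_pXn2r _ 2) ?nnegrE ?mulr_ge0 // exprMn.
have [y0|y0] := eqVneq (snrm y) 0.
  rewrite y0 expr0n mulr0 leNgt; apply/negP => z2.
  (* If y is null the quadratic is affine in t, and this t makes it negative. *)
  have := key ((snrm x ^+ 2 + 1) / (n ^+ 2)).
  rewrite y0 expr0n mulr0 addr0 -mulrA divfK ?gt_eqF //.
  by have := sqr_ge0 (snrm x); lra.
have y2 : 0 < snrm y ^+ 2 by rewrite exprn_gt0 // lt_def y0.
have := key (snrm y ^+ 2)^-1.
rewrite (_ : _ + _ = snrm x ^+ 2 - n ^+ 2 / snrm y ^+ 2).
  by rewrite subr_ge0 ler_pdivrMr.
by field.
Qed.

Lemma snrmD x y : snrm (x + y) <= snrm x + snrm y.
Proof.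
rewrite -(@ler_pXn2r _ 2) ?nnegrE ?addr_ge0 ?snrm_ge0 // snrm_sqr.
rewrite sipDr !sipDl [s x x]sip_self [s y y]sip_self.
have := le_trans (Re_le_nrm _) (cauchy_schwarz x y).
have := le_trans (Re_le_nrm _) (cauchy_schwarz y x).
case: (s x y) => a b; case: (s y x) => c d /=; nra.
Qed.

Lemma snrmZ k x : snrm (k *: x) = nrm (k : R[i]^o) * snrm x.
Proof.
apply/eqP; rewrite -(@eqrXn2 _ 2) ?mulr_ge0 ?snrm_ge0 ?nrm_ge0 //.
rewrite snrm_sqr sipZl sipZr sip_self; apply/eqP.
rewrite -![_ *: _]/(_ * _ : R[i]) mulrA (mulrC (conjc k)) -nrm_sqr_complex.
by rewrite -rmorphM /= exprMn.
Qed.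

End SemiInner.

Section HilbertCompletion.
Variables (R : realType) (X : lmodType R[i]) (s : semi_inner X).
Local Notation q := (snrm s).
Implicit Types (x y z : X) (k : R[i]) (phi psi : X -> R[i]^o).

Definition approx (e : R) phi x := forall y, nrm (phi y - s y x) <= e * q y.

(* The completion consists of the limits, uniformly on the unit ball, of the
   functionals [<-, x>]. *)
Definition hpred : {pred X -> R[i]^o} :=
  [pred phi | `[< forall e, 0 < e -> exists x, approx e phi x >]].

Lemma approxD e e' phi psi x y : approx e phi x -> approx e' psi y ->
  approx (e + e') (phi + psi) (x + y).
Proof.
move=> px py z; rewrite sipDr opprD addrACA (le_trans (nrmD _ _)) // mulrDl.
exact: lerD.
Qed.

Lemma approxZ e k phi x : approx e phi x ->
  approx (nrm (k : R[i]^o) * e) (k *: phi) (k *: x).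
Proof.
move=> px z; rewrite sipZr -[X in X - _]/(k *: phi z) -scalerBr nrmZ -mulrA.
by rewrite ler_wpM2l ?nrm_ge0.
Qed.

Lemma approx_le e e' phi x : e <= e' -> approx e phi x -> approx e' phi x.
Proof.
by move=> ee px z; rewrite (le_trans (px z)) // ler_wpM2r // snrm_ge0.
Qed.

Lemma approx_dist e e' phi x x' : 0 <= e -> 0 <= e' ->
  approx e phi x -> approx e' phi x' -> q (x - x') <= e + e'.
Proof.
move=> e0 e'0 px px'; have [->|q0] := eqVneq (q (x - x')) 0.
  exact: addr_ge0.
have qd : 0 < q (x - x') by rewrite lt_def q0 snrm_ge0.
rewrite -(ler_pM2r qd) -expr2 -nrm_sip_self sipBr.
rewrite (le_trans (nrm_sub_trans (phi (x - x')) _ _)) // mulrDl lerD //.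
by rewrite nrmB.
Qed.

(** An explicit rate, with a free constant so that sums, multiples and bounded operators preserve
    it. *)
Definition rep (u : nat -> X) phi :=
  exists2 c, 0 <= c & forall n, approx (c * rate R n) phi (u n).

Lemma rep_ex phi : phi \in hpred -> exists u, rep u phi.
Proof.
move=> /asboolP phiP.
have [u uP] := choice (fun n => phiP _ (rate_gt0 R n)).
by exists u, 1 => // n; rewrite mul1r.
Qed.

Lemma hpredP u phi : rep u phi -> phi \in hpred.
Proof.
move=> [c c0 uP]; apply/asboolP => e e0.
have c1 : 0 < c + 1 by rewrite ltr_wpDl.
have [N /(_ N (leqnn N)) HN] := rate_lt (divr_gt0 e0 c1).
exists (u N); apply: approx_le (uP N).
move: HN; rewrite ltr_pdivlMr //; have := rate_ge0 R N; nra.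
Qed.

Lemma rep_dist u v phi : rep u phi -> rep v phi ->
  exists2 c, 0 <= c & forall m n, (m <= n)%N -> q (u n - v m) <= c * rate R m.
Proof.
move=> [c c0 uP] [d d0 vP]; exists (c + d); first exact: addr_ge0.
move=> m n mn; have r0 := rate_ge0 R.
rewrite (le_trans (approx_dist _ _ (uP n) (vP m))) ?mulr_ge0 //.
by rewrite mulrDl lerD2r ler_wpM2l // rate_anti.
Qed.

Lemma rep_bounded u phi : rep u phi -> exists2 M, 0 <= M & forall n, q (u n) <= M.
Proof.
move=> up; have [c c0 uP] := rep_dist up up; exists (c + q (u 0%N)).
  by rewrite addr_ge0 // snrm_ge0.
move=> n; rewrite -[u n](subrK (u 0%N)) (le_trans (snrmD _ _ _)) // lerD2r.
rewrite (le_trans (uP _ _ (leq0n n))) //.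
by have := rate_le1 R 0; nra.
Qed.

Lemma sip_rep_dist u v u' v' phi psi :
  rep u phi -> rep v psi -> rep u' phi -> rep v' psi ->
  exists2 c, 0 < c & forall m n, (m <= n)%N ->
    nrm (s (u n) (v n) - s (u' m) (v' m)) <= c * rate R m.
Proof.
move=> up vp up' vp'; have [c c0 uu] := rep_dist up up'.
have [d d0 vv] := rep_dist vp vp'.
have [M M0 uM] := rep_bounded up; have [N N0 vN] := rep_bounded vp'.
exists (M * d + c * N + 1); first by rewrite ltr_wpDl // addr_ge0 // mulr_ge0.
move=> m n mn.
have -> : s (u n) (v n) - s (u' m) (v' m) =
    s (u n) (v n - v' m) + s (u n - u' m) (v' m).
  by rewrite sipBr sipBl addrA subrK.
rewrite (le_trans (nrmD _ _)) //.
have := cauchy_schwarz s (u n) (v n - v' m).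
have := cauchy_schwarz s (u n - u' m) (v' m).
have l1 : q (u n) * q (v n - v' m) <= M * (d * rate R m).
  by rewrite ler_pM ?snrm_ge0 // vv.
have l2 : q (u n - u' m) * q (v' m) <= c * rate R m * N.
  by rewrite ler_pM ?snrm_ge0 // uu.
have := rate_ge0 R m; nra.
Qed.

Lemma rep_iota x : rep (fun _ => x) (fun y => s y x).
Proof. by exists 0 => // n y; rewrite subrr nrm0 !mul0r. Qed.

Lemma repD u v phi psi : rep u phi -> rep v psi ->
  rep (fun n => u n + v n) (phi + psi).
Proof.
move=> [c c0 uP] [d d0 vP]; exists (c + d); first exact: addr_ge0.
by move=> n; rewrite mulrDl; exact: approxD.
Qed.

Lemma repZ k u phi : rep u phi -> rep (fun n => k *: u n) (k *: phi).
Proof.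
move=> [c c0 uP]; exists (nrm (k : R[i]^o) * c); first by rewrite mulr_ge0 ?nrm_ge0.
by move=> n; rewrite -mulrA; exact: approxZ.
Qed.

Lemma repB u v phi psi : rep u phi -> rep v psi ->
  rep (fun n => u n - v n) (phi - psi).
Proof.
move=> up /(repZ (-1)) vp; have := repD up vp.
rewrite scaleN1r; congr rep; apply/funext => n; by rewrite scaleN1r.
Qed.

Lemma hpred_submod : GRing.submod_closed hpred.
Proof.
split.
  apply: (@hpredP (fun _ => 0)); exists 0 => // n y.
  by rewrite sip0r subrr nrm0 !mul0r.
move=> k phi psi /rep_ex[u up] /rep_ex[v vp].
exact: hpredP (repD (repZ k up) vp).
Qed.

(** As elements are functions, vectors at seminorm distance 0 become equal without a quotient. *)
Record hcompl := Hcompl { hfun :> X -> R[i]^o; _ : hfun \in hpred }.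

HB.instance Definition _ := GRing.isSubmodClosed.Build R[i] (X -> R[i]^o)
  hpred hpred_submod.
HB.instance Definition _ := [isSub for hfun].
HB.instance Definition _ := [Choice of hcompl by <:].
HB.instance Definition _ := [SubChoice_isSubLmodule of hcompl by <:].

Implicit Types f g h : hcompl.

Lemma hcomplP f g : (f : X -> R[i]^o) =1 g -> f = g.
Proof. by move=> fg; apply/val_inj/funext. Qed.

Lemma hcompl_rep f : exists u, rep u f.
Proof. by case: f => f fP; exact: rep_ex. Qed.

Lemma hrepD u v f g : rep u f -> rep v g ->
  rep (fun n => u n + v n) (f + g : hcompl).
Proof. exact: repD. Qed.

Lemma hrepZ k u f : rep u f -> rep (fun n => k *: u n) (k *: f : hcompl).
Proof. exact: repZ. Qed.

Lemma hrepB u v f g : rep u f -> rep v g ->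
  rep (fun n => u n - v n) (f - g : hcompl).
Proof. exact: repB. Qed.

Definition iota x : hcompl := Hcompl (hpredP (rep_iota x)).

Lemma hrep_iota x : rep (fun _ => x) (iota x).
Proof. exact: rep_iota. Qed.

Definition hlim f g (l : R[i]^o) := forall u v, rep u f -> rep v g ->
  exists c, forall n, nrm (l - s (u n) (v n)) <= c * rate R n.

Lemma hlim_ex f g : exists l, hlim f g l.
Proof.
have [u up] := hcompl_rep f; have [v vp] := hcompl_rep g.
have [c c0 uv] := sip_rep_dist up vp up vp.
(* The scalars are read as [complex_cstar R], which carries their completeness. *)
have [l lP] := @cauchy_rate R (complex_cstar R) (fun n => s (u n) (v n)) c c0 uv.
exists l => u' v' up' vp'; have [d d0 uv'] := sip_rep_dist up vp up' vp'.
exists (c + d) => n; rewrite (le_trans (nrm_sub_trans (s (u n) (v n)) _ _)) //.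
by rewrite mulrDl; apply: lerD; [exact: lP|exact: uv'].
Qed.

Definition hip f g : R[i]^o := xget 0 (hlim f g).

Lemma hipP f g : hlim f g (hip f g).
Proof.
by have [l lP] := hlim_ex f g; rewrite /hip; case: xgetP => // /(_ l).
Qed.

Lemma hip_uniq f g u v l c : rep u f -> rep v g ->
  (forall n, nrm (l - s (u n) (v n)) <= c * rate R n) -> l = hip f g.
Proof.
move=> up vp lP; have [d dP] := hipP up vp.
apply: (@nrm_rate_eq _ _ _ _ (c + d)) => n.
rewrite (le_trans (nrm_sub_trans (s (u n) (v n)) _ _)) // mulrDl lerD //.
by rewrite nrmB.
Qed.

Lemma hipC f g : hip g f = conjc (hip f g).
Proof.
have [u up] := hcompl_rep f; have [v vp] := hcompl_rep g.
have [c cP] := hipP up vp; symmetry; apply: (hip_uniq (c := c) vp up) => n.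
by rewrite sipC -rmorphB nrm_conjc.
Qed.

Lemma hipDr f g h : hip f (g + h) = hip f g + hip f h.
Proof.
have [u up] := hcompl_rep f; have [v vp] := hcompl_rep g.
have [w wp] := hcompl_rep h.
have [c cP] := hipP up vp; have [d dP] := hipP up wp.
symmetry; apply: (hip_uniq (c := c + d) up (hrepD vp wp)) => n.
by rewrite sipDr opprD addrACA (le_trans (nrmD _ _)) // mulrDl lerD.
Qed.

Lemma hipZr k f g : hip f (k *: g) = k *: hip f g.
Proof.
have [u up] := hcompl_rep f; have [v vp] := hcompl_rep g.
have [c cP] := hipP up vp.
symmetry; apply: (hip_uniq (c := nrm (k : R[i]^o) * c) up (hrepZ k vp)) => n.
by rewrite sipZr -scalerBr nrmZ -mulrA ler_wpM2l ?nrm_ge0.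
Qed.

Lemma hip_ge0 f : 0 <= complex.Re (hip f f).
Proof.
have [u up] := hcompl_rep f; have [c cP] := hipP up up.
rewrite -oppr_le0; apply: (@rate_le0 _ c) => n.
rewrite (le_trans _ (cP n)) // nrmB (le_trans _ (Re_le_nrm _)) //.
by rewrite raddfB /= lerBrDr addNr sip_ge0.
Qed.

Definition hsip : semi_inner hcompl := SemiInner hipC hipDr hipZr hip_ge0.
Local Notation hq := (snrm hsip).

Lemma hip_iota x f : hip (iota x) f = f x.
Proof.
have [u up] := hcompl_rep f; have [c c0 cP] := up.
symmetry; apply: (hip_uniq (c := c * q x) (hrep_iota x) up) => n.
by rewrite mulrAC; exact: cP.
Qed.

Lemma hcompl_linear f k x y : f (k *: x + y) = conjc k *: f x + f y.
Proof.
rewrite -!hip_iota -(sipZl hsip) -(sipDl hsip) /=; congr (hip _ _).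
by apply: hcomplP => z; rewrite /= sipDr sipZr.
Qed.

Lemma hq_iota x : hq (iota x) = q x.
Proof. by rewrite /snrm [hsip _ _]hip_iota. Qed.

Lemma nrm_hcompl f x : nrm (f x) <= q x * hq f.
Proof. by rewrite -hip_iota -hq_iota; exact: (cauchy_schwarz hsip). Qed.

Lemma hq_le_rep u f M N : 0 <= M -> rep u f ->
  (forall n, (N <= n)%N -> q (u n) <= M) -> hq f <= M.
Proof.
move=> M0 up uM; have [c cP] := hipP up up.
rewrite -(@ler_pXn2r _ 2) ?nnegrE ?snrm_ge0 // -subr_le0.
have c0 : 0 <= c.
  by have := le_trans (nrm_ge0 _) (cP 0%N); rewrite pmulr_lge0 // rate_gt0.
apply: (@rate_le0 _ c) => n; set m := maxn n N.
have cm := cP m; have um := uM m (leq_maxr _ _); have u0 := snrm_ge0 s (u m).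
have := Re_le_nrm (hip f f - s (u m) (u m)); rewrite raddfB /=.
rewrite (snrm_sqr hsip) -(snrm_sqr s) /=.
have : c * rate R m <= c * rate R n by rewrite ler_wpM2l // rate_anti // leq_maxl.
nra.
Qed.

Lemma hq_sub_iota f : exists2 u, rep u f &
  exists2 c, 0 <= c & forall n, hq (f - iota (u n)) <= c * rate R n.
Proof.
have [u up] := hcompl_rep f; exists u => //.
have [c c0 cP] := rep_dist up up; exists c => // n.
apply: (@hq_le_rep (fun m => u m - u n) _ _ n).
- by rewrite mulr_ge0 ?rate_ge0.
- exact: hrepB up (hrep_iota (u n)).
- by move=> m nm; exact: cP.
Qed.

(** The functional is tested on its own approximants: q(u_n)^2 is within d [rate R n] q(u_n) of
    f(u_n), so q(u_n) <= M + d [rate R n]. *)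
Lemma hq_le f M : 0 <= M -> (forall x, nrm (f x) <= M * q x) -> hq f <= M.
Proof.
move=> M0 fM; have [u [d d0 dP] [c c0 cP]] := hq_sub_iota f.
rewrite -subr_le0; apply: (@rate_le0 _ (c + d)) => n.
have : hq f <= hq (f - iota (u n)) + q (u n).
  by rewrite -hq_iota -{1}(subrK (iota (u n)) f); exact: snrmD.
have : q (u n) <= M + d * rate R n.
  have r0 := rate_ge0 R n.
  have [->|q0] := eqVneq (q (u n)) 0; first by rewrite addr_ge0 // mulr_ge0.
  have qn : 0 < q (u n) by rewrite lt_def q0 snrm_ge0.
  rewrite -(ler_pM2r qn) -expr2 -nrm_sip_self mulrDl.
  have := nrmD (s (u n) (u n) - f (u n)) (f (u n)); rewrite subrK nrmB.
  have := dP n (u n); have := fM (u n); lra.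
have := cP n; lra.
Qed.

Lemma hq0_eq0 f : hq f = 0 -> f = 0.
Proof.
move=> f0; apply: hcomplP => x; apply/nrm0_eq0/le_anti.
by rewrite nrm_ge0 andbT (le_trans (nrm_hcompl _ _)) // f0 mulr0.
Qed.

Definition hnorm f : R[i] := (hq f)%:C.

Lemma hnormD f g : hnorm (f + g) <= hnorm f + hnorm g.
Proof. by rewrite /hnorm -rmorphD lecR snrmD. Qed.

Lemma hnormZ k f : hnorm (k *: f) = `|k| * hnorm f.
Proof.
by rewrite /hnorm snrmZ rmorphM -[`|k|]/(`|k : R[i]^o|) nrmE.
Qed.

Lemma hnorm0_eq0 f : hnorm f = 0 -> f = 0.
Proof. by move=> /complexI/hq0_eq0. Qed.

HB.instance Definition _ := @Lmodule_isNormed.Build R[i] hcompl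
  hnorm hnormD hnormZ hnorm0_eq0.

Lemma nrm_hq f : nrm f = hq f. Proof. by []. Qed.

Lemma hcompl_complete (F : set_system hcompl) :
  ProperFilter F -> cauchy F -> cvg F.
Proof.
move=> FF /(cauchy_nrm FF) Fc.
have lim x : exists l : R[i]^o, forall e, 0 < e -> F [set f | nrm (l - f x) < e].
  apply: (@complete_nrm R (complex_cstar R) ((fun f => f x) @ F)) => e e0.
  have x0 : 0 < q x + 1 by rewrite ltr_wpDl ?snrm_ge0.
  have [f0 Ff0] := Fc _ (divr_gt0 e0 x0); exists (f0 x).
  rewrite /fmap /=; apply: filterS Ff0 => f /=; rewrite nrm_hq ltr_pdivlMr // => ff.
  apply: le_lt_trans ff; rewrite (le_trans (nrm_hcompl (f0 - f) x)) //.
  by rewrite mulrC ler_wpM2l ?snrm_ge0 // lerDl.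
have [L LP] := choice lim.
have Lunif e : 0 < e -> F [set f | forall x, nrm (L x - hfun f x) <= e * q x].
  move=> e0; have [f0 Ff0] := Fc _ (divr_gt0 e0 (ltr0n _ 2)).
  apply: filterS (Ff0) => f /= f0f x; rewrite leNgt; apply/negP => lt.
  have /(LP x) FL : 0 < nrm (L x - f x) - e * q x by rewrite subr_gt0.
  have [f1 /= [f1L f0f1]] := filter_ex (filterI FL Ff0).
  have := nrm_hcompl (f0 - f) x; have := nrm_hcompl (f0 - f1) x.
  have := nrm_sub_trans (f1 x) (L x) (f x).
  have := nrm_sub_trans (f0 x) (f1 x) (f x).
  rewrite (nrmB (f1 x) (f0 x)) => tr1 tr2 b1 b2.
  have : q x * hq (f0 - f) <= q x * (e / 2) by rewrite ler_wpM2l ?snrm_ge0 // ltW.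
  have : q x * hq (f0 - f1) <= q x * (e / 2) by rewrite ler_wpM2l ?snrm_ge0 // ltW.
  move: b1 b2; rewrite -[(f0 - f1) x]/(f0 x - f1 x) -[(f0 - f) x]/(f0 x - f x); lra.
have LH : L \in hpred.
  apply/asboolP => e e0; have e20 : 0 < e / 2 by rewrite divr_gt0.
  have [f /= fL] := filter_ex (Lunif _ e20).
  have : (f : X -> R[i]^o) \in hpred by case: (f).
  move=> /asboolP/(_ _ e20)[x fx]; exists x => y.
  rewrite (le_trans (nrm_sub_trans (f y) _ _)) //.
  have := fL y; have := fx y; lra.
apply/cvg_ex; exists (Hcompl LH); apply/cvg_nrmP => e e0.
have e20 : 0 < e / 2 by rewrite divr_gt0.
apply: filterS (Lunif _ e20) => f /= fL.
apply: (@le_lt_trans _ _ (e / 2)); last by rewrite ltr_pdivrMr // ltr_pMr // ltr1n.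
by rewrite nrm_hq; apply: hq_le => //; exact: ltW.
Qed.

HB.instance Definition _ := Uniform_isComplete.Build hcompl hcompl_complete.

Lemma hip_le f g : nrm (hip f g) <= nrm f * nrm g.
Proof. exact: (cauchy_schwarz hsip). Qed.

Lemma hip_nrm f : nrm (hip f f) = nrm f ^+ 2.
Proof. exact: (nrm_sip_self hsip). Qed.

Definition hpairing : pairing hcompl R[i]^o :=
  @Pairing _ _ _ hip (fun k : R[i] => conjc k) hipC (sipDl hsip) hipDr
    (sipZl hsip) hipZr hip_le hip_nrm.

Section Lift.
Variables (a b : X -> X) (K : R).
Hypotheses (K0 : 0 <= K) (ab : forall x y, s (a x) y = s x (b y)).
Hypothesis bK : forall x, q (b x) <= K * q x.

Lemma rep_hlift u phi : rep u phi -> rep (a \o u) (phi \o b).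
Proof.
move=> [c c0 uP]; exists (c * K); first exact: mulr_ge0.
move=> n y /=; rewrite sipC ab -sipC (le_trans (uP n _)) //.
by rewrite (mulrAC c K) -(mulrA _ K) ler_wpM2l // mulr_ge0 ?rate_ge0.
Qed.

Lemma hlift_hpred f : hfun f \o b \in hpred.
Proof. by have [u /rep_hlift] := hcompl_rep f; exact: hpredP. Qed.

(** On functionals <-, x> the operator [a] acts by precomposition with its adjoint [b]; hence the
    bound assumed on [b]. *)
Definition hlift f : hcompl := Hcompl (hlift_hpred f).

Lemma hlift_bound f : nrm (hlift f) <= K * nrm f.
Proof.
apply: hq_le => [|x]; first by rewrite mulr_ge0 ?nrm_ge0.
rewrite (le_trans (nrm_hcompl f (b x))) // mulrAC.
by apply: ler_wpM2r; [exact: snrm_ge0|exact: bK].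
Qed.

End Lift.

Lemma hip_hlift a b f g (f' g' : hcompl) :
  (forall x y, s (a x) y = s x (b y)) ->
  (forall u, rep u f -> rep (a \o u) f') ->
  (forall u, rep u g -> rep (b \o u) g') ->
  hip f' g = hip f g'.
Proof.
move=> ab fa gb; have [u up] := hcompl_rep f; have [v vp] := hcompl_rep g.
have [c cP] := hipP up (gb _ vp).
symmetry; apply: (hip_uniq (c := c) (fa _ up) vp) => n.
by rewrite /= ab.
Qed.

End HilbertCompletion.

(** * Positive functionals and the GNS representation *)

Lemma starhom_of (R : realType) (A B : cstarAlgType R) (f : A -> B) :
  (forall (k : R[i]) x y, f (k *: x + y) = k *: f x + f y) ->
  {morph f : x y / x ** y} -> {morph f : x / cstar x} ->
  exists F : {starhom A -> B}, F =1 f.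
Proof.
move=> flin fM fs.
pose lin := GRing.isLinear.Build R[i] A B *:%R f flin.
pose sh := isStarHom.Build R A B f fM fs.
by exists (HB.pack f lin sh : {starhom A -> B}).
Qed.

Section Multipliers.
Variables (R : realType) (P : cstarAlgType R).
Implicit Types x y z : P.

(** [P] as a Hilbert module over itself; its adjointable operators are the multiplier algebra of
    [P]. *)
Definition cstar_pairing : pairing P P.
Proof.
refine (@Pairing R P P (fun x y => cstar x ** y) (@cstar R P) _ _ _ _ _ _ _).
- by move=> x y; rewrite cstarM cstarK.
- by move=> x y z; rewrite cstarD cmulDl.
- by move=> x y z; rewrite cmulDr.
- by move=> k x y; rewrite cstarZc cmulZl.
- by move=> k x y; rewrite cmulZr.
- by move=> x y; rewrite (le_trans (nrmM _ _)) // nrm_star.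
- by move=> x; rewrite nrm_starM.
Defined.

Lemma lmul_adjoint x : is_adjoint cstar_pairing (cmul x) (cmul (cstar x)).
Proof. by move=> y z; rewrite /= cstarM cmulA. Qed.

Lemma lmul_adjointable x : cmul x \in adjointable cstar_pairing.
Proof.
apply/asboolP; split; last by exists (cmul (cstar x)); exact: lmul_adjoint.
by exists (nrm x); split=> [|y]; [exact: nrm_ge0|exact: nrmM].
Qed.

Definition lmul x : adjop cstar_pairing := Adjop (lmul_adjointable x).

Lemma lmulM x y : lmul (x ** y) = lmul x ** lmul y.
Proof. by apply: adjopP => z /=; rewrite cmulA. Qed.

Lemma lmul_star x : lmul (cstar x) = cstar (lmul x).
Proof. by symmetry; apply: adjop_star_uniq; exact: lmul_adjoint. Qed.

Lemma lmul_linear (k : R[i]) x y : lmul (k *: x + y) = k *: lmul x + lmul y.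
Proof. by apply: adjopP => z; rewrite /= cmulDl cmulZl. Qed.

Lemma lmul_eq0 x : lmul x = 0 -> x = 0.
Proof.
move=> x0; rewrite -(cstarK x) [cstar x](@cstarM_eq0 _ _ _ _) ?cstar0 //.
by rewrite cstarK -[x ** _]/(lmul x (cstar x)) x0.
Qed.

End Multipliers.

Record posfun (R : realType) (U : cstarAlgType R) := Posfun {
  pf :> U -> R[i];
  pf_linear : forall (k : R[i]) x y, pf (k *: x + y) = k * pf x + pf y;
  pf_star : forall x, pf (cstar x) = conjc (pf x);
  pf_ge0 : forall x, 0 <= complex.Re (pf (cstar x ** x))
}.

Section PositiveFunctionals.
Variables (R : realType) (U : cstarAlgType R) (e : U).
Hypothesis eP : is_cunit e.

(** With c = z^* z, a functional g norming e + c has g e = 1 and g c = |c| by [pos_nrm_e_add]. From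
    g e = 1 and |t e - x| <= t follows g x >= 0. *)
Lemma posfun_ex (z : U) : z != 0 ->
  exists f : posfun U, 0 < complex.Re (f (cstar z ** z)).
Proof.
move=> z0; set c := cstar z ** z.
have cp : pos e c by apply: pos_starM.
have [cs _] := cp.
have c0 : c != 0 by apply: contra z0 => /eqP/cstarM_eq0 ->.
have [g [glin gle gec]] := norming_functional (e + c).
have gD x y : g (x + y) = g x + g y.
  by have := glin 1 x y; rewrite rmorph1 scale1r mul1r.
have g0 : g 0 = 0 by have := gD 0 0; rewrite addr0; lra.
have gZ t x : g (t%:C *: x) = t * g x by have := glin t x 0; rewrite g0 !addr0.
have ge1 : g e = 1 /\ g c = nrm c.
  have := pos_nrm_e_add eP cp c0; rewrite -gec gD.
  have := gle e; have := gle c; have := nrm_unit_le1 eP; lra.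
have gpos x : pos e x -> 0 <= g x.
  move=> [_ [t t0 xt]]; have := le_trans (gle _) xt.
  by rewrite gD -scaleN1r -(rmorph1 (real_complex R)) -rmorphN !gZ ge1.1; lra.
(* Hahn-Banach gives no compatibility with the star; averaging imposes it and leaves self-adjoint
   arguments unchanged. *)
pose h x := g (2^-1%:C *: (x + cstar x)).
have hD x y : h (x + y) = h x + h y.
  by rewrite /h cstarD addrACA scalerDr gD.
have hZ t x : h (t%:C *: x) = t * h x.
  by rewrite /h cstarZr -scalerDr scalerA mulrC -scalerA gZ.
have hs x : h (cstar x) = h x by rewrite /h cstarK addrC.
have hself x : selfadj x -> h x = g x by move=> xs; rewrite /h xs scale_half.
have hN x : h (- x) = - h x.
  by have := hZ (-1) x; rewrite rmorphN rmorph1 scaleN1r mulN1r.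
(* The complex-linear functional with real part [h]. *)
pose f x := h x +i* (- h ('i%C *: x)).
have flin (k : R[i]) x y : f (k *: x + y) = k * f x + f y.
  case: k => a b.
  have kE v : (a +i* b) *: v = a%:C *: v + b%:C *: ('i%C *: v).
    rewrite scalerA -scalerDl; congr (_ *: _); apply/eqP.
    by rewrite eq_complex /=; apply/andP; split; apply/eqP; ring.
  have ikE : 'i%C *: ((a +i* b) *: x) = a%:C *: ('i%C *: x) - b%:C *: x.
    rewrite kE scalerDr !scalerA -scaleNr; congr (_ *: _ + _ *: _).
      by rewrite mulrC.
    by apply/eqP; rewrite eq_complex /=; apply/andP; split; apply/eqP; ring.
  rewrite /f scalerDr ikE kE !hD hN !hZ.
  by apply/eqP; rewrite eq_complex /=; apply/andP; split; apply/eqP; ring.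
have fs x : f (cstar x) = conjc (f x).
  rewrite /f hs; congr (_ +i* _).
  have -> : 'i%C *: cstar x = - cstar ('i%C *: x).
    rewrite cstarZc -scaleNr; congr (_ *: _).
    by apply/eqP; rewrite eq_complex /= opprK oppr0 !eqxx.
  by rewrite hN hs.
have fge0 x : 0 <= complex.Re (f (cstar x ** x)).
  have xp : pos e (cstar x ** x) by apply: pos_starM.
  by rewrite /= hself ?gpos //; case: xp.
exists (Posfun flin fs fge0); rewrite /= hself // ge1.2 lt_def nrm_ge0 andbT.
by apply: contra c0 => /eqP/nrm0_eq0 ->.
Qed.

Definition posfun_add (f g : posfun U) : posfun U.
Proof.
refine (@Posfun R U (fun x => f x + g x) _ _ _).
- by move=> k x y; rewrite !pf_linear mulrDr addrACA.
- by move=> x; rewrite !pf_star rmorphD.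
- by move=> x; rewrite raddfD /= addr_ge0 // pf_ge0.
Defined.

Section GNS.
Variable f : posfun U.
Implicit Types x y z : U.

Lemma pfD x y : f (x + y) = f x + f y.
Proof. by rewrite -{1}(scale1r x) pf_linear mul1r. Qed.

Lemma pf0 : f 0 = 0.
Proof. by apply: (addrI (f 0)); rewrite -pfD !addr0. Qed.

Lemma pfZ (k : R[i]) x : f (k *: x) = k * f x.
Proof. by rewrite -{1}(addr0 (k *: x)) pf_linear pf0 addr0. Qed.

Definition gns_form : semi_inner U.
Proof.
refine (@SemiInner R U (fun x y => f (cstar x ** y)) _ _ _ _).
- by move=> x y; rewrite -pf_star cstarM cstarK.
- by move=> x y z; rewrite cmulDr pfD.
- by move=> k x y; rewrite cmulZr pfZ.
- exact: pf_ge0.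
Defined.

Lemma gns_adjoint x y z : gns_form (x ** y) z = gns_form y (cstar x ** z).
Proof. by rewrite /= cstarM cmulA. Qed.

(** |x|^2 e - x^* x is the square of a self-adjoint s, and positivity of f at (s y)^* (s y) is the
    claim. *)
Lemma gns_bound x y : snrm gns_form (x ** y) <= nrm x * snrm gns_form y.
Proof.
rewrite -(@ler_pXn2r _ 2) ?nnegrE ?mulr_ge0 ?snrm_ge0 ?nrm_ge0 //.
rewrite exprMn !snrm_sqr /=.
have [s [ss sE _]] : exists s, [/\ selfadj s,
    s ** s = (nrm x ^+ 2)%:C *: e - cstar x ** x &
    forall z, ((nrm x ^+ 2)%:C *: e - cstar x ** x) ** z =
      z ** ((nrm x ^+ 2)%:C *: e - cstar x ** x) -> s ** z = z ** s].
  apply: (pos_sqrt eP); split.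
    by apply: selfadjB; [apply/selfadjZ/selfadj_unit|exact: selfadj_starM].
  exists (nrm x ^+ 2); first exact: sqr_ge0.
  by rewrite opprB addrC subrK nrm_starM.
have := pf_ge0 f (s ** y).
rewrite cstarM ss -cmulA (cmulA s) sE cmulBl cmulBr cmulZl cmulZr (cmul_e eP).
have ReE (t : R) (k l : R[i]) :
    complex.Re (t%:C * k - l) = t * complex.Re k - complex.Re l.
  by case: k l => [a b] [c d] /=; ring.
by rewrite -scaleN1r pfD !pfZ mulN1r ReE subr_ge0 cstarM -!cmulA.
Qed.

Local Notation hilb := (hcompl gns_form).

Lemma gns_bound_star x y :
  snrm gns_form (cstar x ** y) <= nrm x * snrm gns_form y.
Proof. by rewrite -(nrm_star x) gns_bound. Qed.

Definition gns_op x : hilb -> hilb :=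
  hlift (nrm_ge0 x) (gns_adjoint x) (gns_bound_star x).

Lemma gns_op_adjoint x :
  is_adjoint (hpairing gns_form) (gns_op x) (gns_op (cstar x)).
Proof.
move=> g h; apply: (hip_hlift (a := cmul x) (b := cmul (cstar x))).
- exact: gns_adjoint.
- by move=> u; exact: (rep_hlift (nrm_ge0 x) (gns_adjoint x) (gns_bound_star x)).
- move=> u; apply: (rep_hlift (nrm_ge0 (cstar x)) (gns_adjoint (cstar x))).
  exact: gns_bound_star.
Qed.

Lemma gns_op_adjointable x : gns_op x \in adjointable (hpairing gns_form).
Proof.
apply/asboolP; split; last by exists (gns_op (cstar x)); exact: gns_op_adjoint.
exists (nrm x); split=> [|g]; first exact: nrm_ge0.
exact: hlift_bound.
Qed.

Definition gns x : adjop (hpairing gns_form) := Adjop (gns_op_adjointable x).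

Lemma gnsE x (g : hilb) y : gns x g y = g (cstar x ** y). Proof. by []. Qed.

Lemma gnsM x y : gns (x ** y) = gns x ** gns y.
Proof.
by apply: adjopP => g; apply: hcomplP => z; rewrite !gnsE cstarM cmulA.
Qed.

Lemma gns_star x : gns (cstar x) = cstar (gns x).
Proof. by symmetry; apply: adjop_star_uniq; exact: gns_op_adjoint. Qed.

Lemma gns_linear (k : R[i]) x y : gns (k *: x + y) = k *: gns x + gns y.
Proof.
apply: adjopP => g; apply: hcomplP => z.
rewrite gnsE cstarD cstarZc cmulDl cmulZl hcompl_linear.
by have -> : conjc (conjc k) = k by exact: conjcK.
Qed.

Lemma gns_unit : gns e = @adjop1 _ _ _ _.
Proof.
apply: adjopP => g; apply: hcomplP => z.
by rewrite gnsE (selfadj_unit eP) (cmul_e eP).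
Qed.

Lemma gns_cyclic x : gns x (iota gns_form e) = iota gns_form x.
Proof.
by apply: hcomplP => y; rewrite gnsE /= cstarM cstarK (cmulr_e eP).
Qed.

Lemma nrm_gns_cyclic x :
  nrm (gns x (iota gns_form e)) ^+ 2 = complex.Re (f (cstar x ** x)).
Proof. by rewrite gns_cyclic nrm_hq hq_iota snrm_sqr. Qed.

End GNS.
End PositiveFunctionals.

(** * Free products *)

Section RankOne.
Variables (R : realType) (H : completeNormedModType R[i]).
Variable p : pairing H R[i]^o.
Hypothesis pC : forall x y, p y x = conjc (p x y).
Hypothesis pxx : forall x, p x x = (nrm x ^+ 2)%:C.
Implicit Types (x y z v w : H) (S T : adjop p).

Definition reflect_coef v : R := 2 / nrm v ^+ 2.

Definition reflection v x : H := x - (reflect_coef v)%:C *: (p v x *: v).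

Lemma reflection_adjointable v : reflection v \in adjointable p.
Proof.
apply/asboolP; split.
  exists (1 + `|reflect_coef v| * (nrm v * nrm v)); split.
    by rewrite addr_ge0 // !mulr_ge0 ?nrm_ge0.
  move=> x; rewrite /reflection (le_trans (nrmD _ _)) // nrmN mulrDl mul1r lerD2l.
  rewrite nrmZr nrmZ -mulrA ler_wpM2l //.
  by have := form_le p v x; have := nrm_ge0 v; nra.
exists (reflection v) => x y.
rewrite /reflection formDl formDr formNl formNr !formZl !formZr conjc_real -pC.
by rewrite -![_ *: _]/(_ * _ : R[i]); congr (_ - _ * _); rewrite mulrC.
Qed.

Definition reflop v : adjop p := Adjop (reflection_adjointable v).

Lemma refl_selfadj v : selfadj (reflop v).
Proof.
apply: adjop_star_uniq => x y /=.
rewrite /reflection formDl formDr formNl formNr !formZl !formZr conjc_real -pC.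
by rewrite -![_ *: _]/(_ * _ : R[i]); congr (_ - _ * _); rewrite mulrC.
Qed.

Lemma reflK v : v != 0 -> reflop v ** reflop v = adjop1 p.
Proof.
move=> v0; apply: adjopP => x; rewrite /= /reflection.
have n0 : nrm v ^+ 2 != 0.
  by rewrite sqrf_eq0; apply: contra v0 => /eqP/nrm0_eq0 ->.
have pvE : p v (x - (reflect_coef v)%:C *: (p v x *: v)) = - p v x.
  rewrite formDr formNr !formZr pxx; set k := p v x.
  rewrite -[_%:C *: _]/((reflect_coef v)%:C * (k * (nrm v ^+ 2)%:C) : R[i]).
  rewrite mulrCA -rmorphM /= /reflect_coef divfK // rmorph_nat.
  by apply: (@etrans R[i] _ (k - k * 2)) => //; ring.
by rewrite pvE scaleNr scalerN opprK subrK.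
Qed.

(** The diagonal at k y + x gives k s(x, y) + conj(k) s(y, x) = 0; k = 1 and k = i leave only 0. *)
Lemma sesqui_diag0 (s : H -> H -> H) :
  (forall (k : R[i]) x y z, s x (k *: y + z) = k *: s x y + s x z) ->
  (forall (k : R[i]) x y z, s (k *: x + y) z = conjc k *: s x z + s y z) ->
  (forall x, s x x = 0) -> forall x y, s x y = 0.
Proof.
move=> sr sl s0 x y.
have kE (k : R[i]) : k *: s x y + conjc k *: s y x = 0.
  have := s0 (k *: y + x); rewrite sr !sl !s0 scaler0 add0r.
  by rewrite addr0.
have s1 := kE 1; have si := kE 'i%C.
rewrite conjc1 !scale1r in s1.
have yx : s y x = - s x y by apply/eqP; rewrite -addr_eq0 addrC s1.
have ci : conjc 'i%C = - 'i%C :> R[i] by apply/eqP; rewrite eq_complex /= oppr0 !eqxx.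
move: si; rewrite yx ci scaleNr scalerN opprK -scalerDl => /eqP.
rewrite scaler_eq0 -mulr2n mulrn_eq0 /= => /orP[|/eqP //].
by rewrite eq_complex /= oner_eq0 andbF.
Qed.

(* Comparing [u = 1] with the reflections along vectors [v] replaces [u] by the
   rank-one operators [<v, .> v], and by polarization by all [<v, .> w]. *)
Lemma rank_one_proportional (a a1 b b1 : adjop p) x :
  (forall u : adjop p, selfadj u -> u ** u = adjop1 p ->
    a1 ** u ** b = a ** u ** b1) ->
  a1 x != 0 -> exists k : R[i], b = k *: b1.
Proof.
move=> au a1x.
have au1 z : a1 (b z) = a (b1 z).
  have [e1 _] := adjop1_unit (adjop1 p).
  have := au _ (selfadj_unit (@adjop1_unit _ _ _ p)) e1.
  by move=> /(congr1 (fun T : adjop p => T z)).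
have diag z y : p y (b z) *: a1 y - p y (b1 z) *: a y = 0.
  have [->|y0] := eqVneq y 0; first by rewrite !adjop0 !scaler0 subrr.
  have := au _ (refl_selfadj y) (reflK y0).
  move=> /(congr1 (fun T : adjop p => T z)) /=; rewrite /reflection.
  rewrite !adjop_sub !adjop_scale au1 => /addrI/oppr_inj/eqP.
  rewrite -subr_eq0 -scalerBr scaler_eq0 => /orP[|/eqP //].
  have n0 : nrm y != 0 by apply: contra y0 => /eqP/nrm0_eq0 ->.
  by rewrite fmorph_eq0 mulf_eq0 invr_eq0 sqrf_eq0 (negPf n0) pnatr_eq0.
have full z y x' : p y (b z) *: a1 x' = p y (b1 z) *: a x'.
  apply/eqP; rewrite -subr_eq0; apply/eqP.
  apply: (sesqui_diag0 (s := fun y x' => p y (b z) *: a1 x' - p y (b1 z) *: a x')).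
  - move=> k y1 y2 y3; rewrite !adjop_linear !scalerDr opprD addrACA scalerN.
    by rewrite !scalerA ![k * _]mulrC.
  - move=> k y1 y2 y3; rewrite !formDl !formZl !scalerDl opprD addrACA scalerBr.
    by rewrite !scalerA.
  - exact: diag.
pose n := (nrm (a1 x) ^+ 2)%:C : R[i].
have n0 : n != 0.
  by rewrite fmorph_eq0 sqrf_eq0; apply: contra a1x => /eqP/nrm0_eq0 ->.
exists (n^-1 * p (a1 x) (a x)); apply: adjopP => z; apply: (@form_inj _ _ _ p) => y.
rewrite pC [RHS]pC; congr conjc.
(* Pairing with [a1 x] makes the left coefficient |a1 x|^2, which can be divided out. *)
have := congr1 (p (a1 x)) (full z y x); rewrite !formZr pxx.
rewrite -/n => yE.
have {}yE : p y (b z) * n = p y (b1 z) * p (a1 x) (a x) :> R[i] := yE.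
rewrite -[RHS]/(n^-1 * p (a1 x) (a x) * p y (b1 z) : R[i]).
by rewrite -mulrA [_ * p y _]mulrC -yE mulrCA mulVf // mulr1.
Qed.

End RankOne.

Section SeparatingFunctional.
Variables (R : realType) (U : cstarAlgType R) (e : U).
Hypothesis eP : is_cunit e.

(* Three functionals are enough: in the GNS space of the second, [b] is equal
   to at most one multiple of [b1], which the third one separates from [b]. *)
Lemma separating_posfun (w b b1 : U) : w != 0 ->
  (forall k : R[i], b - k *: b1 != 0) -> b1 != 0 ->
  exists f : posfun U, complex.Re (f (cstar w ** w)) != 0 /\
    forall k : R[i], complex.Re (f (cstar (b - k *: b1) ** (b - k *: b1))) != 0.
Proof.
move=> w0 bk b10.
have [f0 f0w] := posfun_ex eP w0.
have [f1 f1b1] := posfun_ex eP b10.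
pose d k := b - k *: b1.
pose Z (f : posfun U) x := complex.Re (f (cstar x ** x)).
have Zge (f : posfun U) x : 0 <= Z f x by exact: pf_ge0.
have [[k0 k0P]|nk] := pselect (exists k0, Z f1 (d k0) = 0); last first.
  exists (posfun_add f0 f1); split=> [|k]; rewrite /= raddfD /=.
    by rewrite gt_eqF // ltr_wpDr // pf_ge0.
  rewrite gt_eqF // ltr_wpDl ?pf_ge0 // lt_def pf_ge0 andbT.
  by apply/eqP => k0; apply: nk; exists k.
have [f2 f2d] := posfun_ex eP (bk k0).
exists (posfun_add (posfun_add f0 f1) f2); split=> [|k]; rewrite /= !raddfD /=.
  by rewrite gt_eqF // ltr_wpDr ?pf_ge0 // ltr_wpDr // pf_ge0.
have [->|kk0] := eqVneq k k0.
  by rewrite gt_eqF // ltr_wpDl // addr_ge0 // pf_ge0.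
rewrite gt_eqF // ltr_wpDr ?pf_ge0 // ltr_wpDl ?pf_ge0 //.
rewrite lt_def pf_ge0 andbT; apply/eqP => f1k.
(* If [f1] vanished at both parameters, the difference (k - k0) b1 would be null, against the choice
   of [f1]. *)
have q0 x : Z f1 x = 0 -> snrm (gns_form f1) x = 0.
  by move=> x0; rewrite /snrm [complex.Re _]x0 sqrtr0.
have qk := q0 _ f1k; have qk0 := q0 _ k0P.
have : snrm (gns_form f1) (d k0 - d k) <= 0.
  rewrite (le_trans (snrmD _ _ _)) // qk0 -scaleN1r snrmZ qk mulr0 addr0 //.
have -> : d k0 - d k = (k - k0) *: b1.
  by rewrite /d opprB addrC addrA subrK scalerBl.
rewrite snrmZ; apply/negP; rewrite -ltNge mulr_gt0 //.
  by rewrite lt_def nrm_ge0 andbT; apply: contra kk0 => /eqP/nrm0_eq0/eqP; rewrite subr_eq0.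
by rewrite sqrtr_gt0.
Qed.

End SeparatingFunctional.

Lemma gns_pairingC (R : realType) (X : lmodType R[i]) (s : semi_inner X)
  (x y : hcompl s) : hpairing s y x = conjc (hpairing s x y).
Proof. exact: hipC. Qed.

Lemma gns_pairing_self (R : realType) (X : lmodType R[i]) (s : semi_inner X)
  (x : hcompl s) : hpairing s x x = (nrm x ^+ 2)%:C.
Proof. exact: (sip_self (hsip s)). Qed.

(* The two cases on [D] enter through the hypothesis [scal] only. *)
Lemma free_product_independent (R : realType) (A B D : cstarAlgType R)
    (phiA : {starhom D -> A}) (phiB : {starhom D -> B})
    (P : cstarAlgType R) (sA : {starhom A -> P}) (sB : {starhom B -> P})
    (freeP : full_amalgamated_free_product phiA phiB sA sB)
    (scal : forall d, exists k : R[i], forall x, sA (phiA d) ** x = k *: x)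
    (a a1 : A) (b b1 : B) :
  a1 != 0 -> b1 != 0 -> (forall k : R[i], b - k *: b1 != 0) ->
  sA a1 ** sB b <> sA a ** sB b1.
Proof.
case: freeP => injA injB amalg _ univ a10 b10 bk eq.
have nzA x : x != 0 -> lmul (sA x) != 0.
  by apply: contra => /eqP/lmul_eq0 x0; apply/eqP/injA; rewrite x0 linear0.
have nzB x : x != 0 -> lmul (sB x) != 0.
  by apply: contra => /eqP/lmul_eq0 x0; apply/eqP/injB; rewrite x0 linear0.
have eP := @adjop1_unit _ _ _ (cstar_pairing P).
have lmulBZ (k : R[i]) : lmul (sB b) - k *: lmul (sB b1) = lmul (sB (b - k *: b1)).
  by rewrite addrC -scaleNr -lmul_linear -linearP scaleNr addrC.
have [f [fa fb]] : exists f : posfun (adjop (cstar_pairing P)),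
    complex.Re (f (cstar (lmul (sA a1)) ** lmul (sA a1))) != 0 /\
    forall k : R[i], let z := lmul (sB b) - k *: lmul (sB b1) in
      complex.Re (f (cstar z ** z)) != 0.
  by apply: (separating_posfun eP); rewrite ?nzA ?nzB // => k; rewrite lmulBZ nzB.
(* [f] lives on the multiplier algebra, hence the passage through left multiplication. *)
pose rho x := gns eP f (lmul x).
have rhoM x y : rho (x ** y) = rho x ** rho y by rewrite /rho lmulM gnsM.
have rho_star x : rho (cstar x) = cstar (rho x) by rewrite /rho lmul_star gns_star.
have rho_lin (k : R[i]) x y : rho (k *: x + y) = k *: rho x + rho y.
  by rewrite /rho lmul_linear gns_linear.
have [piA piAE] : exists pi : {starhom A -> adjop (hpairing (gns_form f))},
    pi =1 rho \o sA.
  apply: starhom_of => [k x y|x y|x] /=.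
  - by rewrite linearP rho_lin.
  - by rewrite starhomM rhoM.
  - by rewrite starhom_star rho_star.
have [k bE] : exists k : R[i], rho (sB b) = k *: rho (sB b1).
  apply: (@rank_one_proportional _ _ _ (@gns_pairingC _ _ _)
    (@gns_pairing_self _ _ _) (rho (sA a)) (rho (sA a1)) _ _
    (iota (gns_form f) (adjop1 _))); last first.
    (* At the cyclic vector, the squared norm of [rho (sA a1)] is a value of [f] chosen nonzero. *)
    apply: contra fa => /eqP x0.
    by rewrite -(nrm_gns_cyclic eP) [gns _ _ _ _]x0 nrm0 expr0n.
  move=> u us uu.
  have uK T : T ** u ** u = T.
    by rewrite -cmulA uu; have [_] := adjop1_unit T.
  have [piB piBE] : exists pi : {starhom B -> adjop (hpairing (gns_form f))},
      pi =1 (fun x => u ** rho (sB x) ** u).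
    apply: starhom_of => [k x y|x y|x] /=.
    - by rewrite linearP rho_lin cmulDr cmulDl cmulZr cmulZl.
    - by rewrite starhomM rhoM !cmulA uK.
    - by rewrite starhom_star rho_star !cstarM us cmulA.
  have [|pi [piA' piB']] := univ _ piA piB.
    move=> d /=; rewrite piAE piBE /=.
    have -> : sB (phiB d) = sA (phiA d) by rewrite -[LHS]amalg.
    (* A scalar operator is unchanged by conjugation with [u], which gives the agreement on [D]. *)
    have [k kP] := scal d.
    have -> : rho (sA (phiA d)) = k *: adjop1 _.
      rewrite /rho.
      have -> : lmul (sA (phiA d)) = k *: adjop1 _ :> adjop (cstar_pairing P).
        by apply: adjopP => x; rewrite /= kP.
      have g0 : gns eP f 0 = 0.
        have := gns_linear eP f (-1) 0 0.
        by rewrite scaler0 addr0 scaleN1r addNr.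
      by rewrite -(addr0 (k *: adjop1 _)) gns_linear g0 addr0 gns_unit.
    rewrite cmulZr cmulZl; have [_ ->] := @adjop1_unit _ _ _ _ u.
    by rewrite uu.
  have := congr1 pi eq; rewrite !starhomM.
  rewrite -[pi (sA a1)]/((pi \o sA) a1) -[pi (sA a)]/((pi \o sA) a).
  rewrite -[pi (sB b)]/((pi \o sB) b) -[pi (sB b1)]/((pi \o sB) b1).
  (* Both sides end in a factor [u], removed by multiplying with [u] once more. *)
  rewrite !piA' !piB' !piAE !piBE /= => /(congr1 (fun T => T ** u)).
  by rewrite !cmulA !uK.
have r0 : rho (sB (b - k *: b1)) = 0.
  by rewrite addrC -scaleNr linearP rho_lin bE scaleNr addNr.
case/eqP: (fb k); rewrite lmulBZ -(nrm_gns_cyclic eP).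
by rewrite -[gns _ _ _]/(rho _) r0 nrm0 expr0n.
Qed.

(** * The unit of an amalgamated product, and the conclusion *)

Lemma closed_nrm (R : realType) (V : normedModType R[i]) (S : set V) :
  (forall x, (forall t : R, 0 < t -> exists2 y, S y & nrm (x - y) < t) -> S x) ->
  closed S.
Proof.
move=> SP x Sx; apply: SP => t t0.
have /Sx[y [Sy xy]] : nbhs x (ball x t%:C) by apply: nbhsx_ballx; rewrite ltcR.
exists y => //.
by move: xy; rewrite -ball_normE /ball_ /= nrmE ltcR.
Qed.

(** It carries a unit from the generators to the whole algebra. Both sides are required because the
    star exchanges them. *)
Lemma fixed_subalgebra (R : realType) (P : cstarAlgType R) (v : P) :
  selfadj v -> cstar_subalgebra [set x | v ** x = x /\ x ** v = x].
Proof.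
move=> vs; split => /=.
- by rewrite cmul0l cmul0r.
- by move=> x y [vx xv] [vy yv]; rewrite cmulDl cmulDr vx xv vy yv.
- by move=> k x [vx xv]; rewrite cmulZl cmulZr vx xv.
- by move=> x y [vx xv] [vy yv]; rewrite cmulA vx -cmulA yv.
- by move=> x [vx xv]; rewrite -{1 2}vs -!cstarM vx xv.
- apply: closed_nrm => x xP.
  have eq0 z : (forall t : R, 0 < t -> nrm z <= (nrm v + 1) * t) -> z = 0.
    move=> zt; apply/nrm0_eq0/le_anti; rewrite nrm_ge0 andbT.
    have := @rate_le0 R (nrm v + 1) (nrm z); apply => n; apply: zt.
    exact: rate_gt0.
  split; apply/eqP; rewrite -subr_eq0; apply/eqP/eq0 => t /xP[y [vy yv] xy].
    have -> : v ** x - x = v ** (x - y) - (x - y) by rewrite cmulBr vy opprB addrA subrK.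
    rewrite (le_trans (nrmD _ _)) // nrmN mulrDl mul1r lerD ?(ltW xy) //.
    by rewrite (le_trans (nrmM _ _)) // ler_wpM2l ?nrm_ge0 // ltW.
  have -> : x ** v - x = (x - y) ** v - (x - y) by rewrite cmulBl yv opprB addrA subrK.
  rewrite (le_trans (nrmD _ _)) // nrmN mulrDl mul1r lerD ?(ltW xy) //.
  by rewrite (le_trans (nrmM _ _)) // mulrC ler_wpM2l ?nrm_ge0 // ltW.
Qed.

(** The units of [A] and [B] have the same image, both coming from [v]; it acts as a unit on the
    generators. *)
Lemma amalgamated_unit (R : realType) (A B D : cstarAlgType R)
    (phiA : {starhom D -> A}) (phiB : {starhom D -> B})
    (P : cstarAlgType R) (sA : {starhom A -> P}) (sB : {starhom B -> P}) (v : D) :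
  full_amalgamated_free_product phiA phiB sA sB ->
  is_cunit (phiA v) -> is_cunit (phiB v) -> is_cunit (sA (phiA v)).
Proof.
move=> [_ _ amalg gen _] uA uB x.
have vs : selfadj (sA (phiA v)).
  by rewrite /selfadj -starhom_star (selfadj_unit uA).
have : cstar_generated (range (sA : A -> P) `|` range (sB : B -> P)) x.
  by rewrite gen.
apply: (smallest_sub (fixed_subalgebra vs)) => _ [[a _ <-]|[b _ <-]] /=.
  by rewrite -!starhomM; have [-> ->] := uA a.
by rewrite [sA _]amalg -!starhomM; have [-> ->] := uB b.
Qed.

Theorem corollary3p4 (R : realType) (A B D A' B' D' : cstarAlgType R)
    (iA : {starhom A -> A'}) (iB : {starhom B -> B'}) (iD : {starhom D -> D'})
    (phiA : {starhom D -> A}) (phiB : {starhom D -> B})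
    (phiA' : {starhom D' -> A'}) (phiB' : {starhom D' -> B'})
    (iA_inj : injective iA) (iB_inj : injective iB) (iD_inj : injective iD)
    (phiA_inj : injective phiA) (phiB_inj : injective phiB)
    (phiA'_inj : injective phiA') (phiB'_inj : injective phiB')
    (compatA : iA \o phiA =1 phiA' \o iD)
    (compatB : iB \o phiB =1 phiB' \o iD)
    (P : cstarAlgType R) (sA : {starhom A -> P}) (sB : {starhom B -> P})
    (freeP : full_amalgamated_free_product phiA phiB sA sB)
    (P' : cstarAlgType R) (sA' : {starhom A' -> P'}) (sB' : {starhom B' -> P'})
    (freeP' : full_amalgamated_free_product phiA' phiB' sA' sB')
    (lam : {starhom P -> P'})
    (lamA : lam \o sA =1 sA' \o iA) (lamB : lam \o sB =1 sB' \o iB)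
    (caseD : (forall d : D, d = 0) \/
       [/\ exists f : {starhom complex_cstar R -> D}, bijective f,
           cunital A, cunital B, unital_hom phiA & unital_hom phiB])
    (d : D') (a : A) (b : B)
    (had : (range (iA : A -> A') `\ 0) (iA a ** phiA' d))
    (hdb : range (iB : B -> B') (phiB' d ** iB b))
    (hdb_scal : ~ exists z : R[i], phiB' d ** iB b = z *: iB b) :
  ~ injective lam.
Proof.
move=> lam_inj.
have [[a1 _ a1E] ad0] := had; have [b1 _ b1E] := hdb.
have a10 : a1 != 0 by apply/eqP => a10; apply: ad0; rewrite /= -a1E a10 linear0.
have b_nscal z : b1 != z *: b.
  apply/eqP => b1z; apply: hdb_scal; exists z.
  by rewrite -b1E b1z linearZ.
have b10 : b1 != 0 by rewrite -(scale0r b).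
(* Non-proportionality is turned around: k = 0 would give b = 0 and d b = 0 b, and any other k would
   make b1 a multiple of b. *)
have bk (k : R[i]) : b - k *: b1 != 0.
  apply/eqP => /subr0_eq bE; have [k0|k0] := eqVneq k 0.
    have := hdb_scal; rewrite bE k0 scale0r linear0 cmul0r; apply.
    by exists 0; rewrite scale0r.
  by have := b_nscal k^-1; rewrite bE scalerK // eqxx.
(* The scalar is 0 if D = 0; if D is the complex field it is the number corresponding to [c]. *)
have scal c : exists k : R[i], forall x, sA (phiA c) ** x = k *: x.
  case: caseD => [D0|[[f [g fK gK]] _ _ uA uB]].
    by exists 0 => x; rewrite (D0 c) !linear0 cmul0l scale0r.
  have f1 : is_cunit (f (1 : R[i])).
    move=> y; rewrite -(gK y) -!starhomM.
    by split; congr (f _); [exact: (mul1r (g y : R[i]))|exact: (mulr1 (g y : R[i]))].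
  have uP := amalgamated_unit freeP (uA _ f1) (uB _ f1).
  exists (g c : R[i]) => x.
  have {1}-> : c = (g c : R[i]) *: f (1 : R[i]).
    by rewrite -linearZ /= -{1}(gK c); congr (f _); exact: (esym (mulr1 (g c : R[i]))).
  by rewrite !linearZ /= cmulZl; have [-> _] := uP x.
apply: (free_product_independent freeP scal (a := a) a10 b10 bk).
(* In the target both products equal a d b, with [d] read through [A'] on one side and through [B']
   on the other. *)
have [_ _ amalg' _ _] := freeP'.
apply: lam_inj; rewrite !starhomM.
rewrite [lam (sA _)]lamA [lam (sB _)]lamB [lam (sA _)]lamA [lam (sB _)]lamB /=.
by rewrite a1E b1E !starhomM [sA' (phiA' d)]amalg' cmulA.
Qed.
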